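(* Let $G$ be a random graph on $n$ vertices drawn from the Chung-Lu model with power-law exponent $2<\beta<3$, and suppose a preprocessing phase has acquired (queried) an inner ring $L_0$ produced by CoreGen of size $n^{1-\Theta(1/\log\log n)}$. Then the average (over inquiry pairs) number of node queries made by the WormHole routing procedure to compute a path between a pair of vertices is bounded by $n^{\Theta(1/\log\log n)}$.
   Context: Node query model: querying a vertex $v$ reveals its neighbor list $\Gamma(v)$; query complexity is the number of queries. Chung-Lu model: expected degrees $w_1\ge\dots\ge w_n$ following a power law with exponent $\beta$, $W=\sum_i w_i$, each pair $\{i,j\}$ independently an edge with probability $w_iw_j/W$. CoreGen (target size $k$): start with $L_0=\{v\}$, $L_1=\Gamma(v)$; while $|L_0|<k$, move into $L_0$ a vertex $u\in L_1$ with maximum number of neighbors in $L_0$ (ties random) and set $L_1\leftarrow(L_1\cup\Gamma(u))\setminus L_0$. WormHole routing for $(s,t)$: grow BFS trees $T(s),T(t)$ from $s,t$ level by level; a tree stops once it has been expanded one level after its neighborhood first meets $L_0$, recording $C(i)=\Gamma(T(i))\cap L_0$; stop when the trees intersect (return the path through the intersection) or both $C(s),C(t)$ are nonempty, in which case run bidirectional BFS inside $G[L_0]$ between $C(s)$ and $C(t)$ and return the concatenated path. Vertices of $L_0$ were already queried during preprocessing and cost no further queries. *)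

(* Defs.v *)
From HB Require Import structures.
From mathcomp Require Import all_boot all_order all_algebra.
From mathcomp Require Import all_classical all_reals all_analysis.

Set Implicit Arguments.
Unset Strict Implicit.
Unset Printing Implicit Defensive.

Import Order.TTheory GRing.Theory Num.Theory.
Import numFieldNormedType.Exports.

Local Open Scope ring_scope.

(* A simple graph on 'I_n is its edge set, a set of two-element subsets of
   'I_n. The definitions below take arbitrary [G : graph n]; the Chung-Lu
   distribution is supported on subsets of [vpairs n], so loops never occur. *)
Notation graph n := {set {set 'I_n}}.

Definition vpairs n : graph n := [set e : {set 'I_n} | #|e| == 2%N].

(* The answer to a node query at v. *)
Definition nbr n (G : graph n) (v : 'I_n) : {set 'I_n} :=
  [set u | [set u; v] \in G].

Definition nbrs n (G : graph n) (A : {set 'I_n}) : {set 'I_n} :=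
  \bigcup_(u in A) nbr G u.

Section ChungLu.
Variable R : realType.
Implicit Types (beta : R).

Definition cl_total n (w : 'I_n -> R) : R := \sum_i w i.

(* For e = {i, j} this is w_i w_j / W. *)
Definition cl_edge_prob n (w : 'I_n -> R) (e : {set 'I_n}) : R :=
  (\prod_(i in e) w i) / cl_total w.

Definition cl_pmf n (w : 'I_n -> R) (G : graph n) : R :=
  \prod_(e in vpairs n)
    (if e \in G then cl_edge_prob w e else 1 - cl_edge_prob w e).

Definition cl_pr n (w : 'I_n -> R) (E : pred (graph n)) : R :=
  \sum_(G in powerset (vpairs n) | E G) cl_pmf w G.

(* Indices start at 0, so w_1 >= ... >= w_n reads w 0 >= ... >= w (n - 1).
   The last conjunct says that the edge probabilities are at most 1. *)
Definition cl_weights n (w : 'I_n -> R) : Prop :=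
  [/\ forall i, 0 < w i,
      forall i j : 'I_n, (i <= j)%N -> w j <= w i &
      forall i j, i != j -> w i * w j <= cl_total w].

Definition inv_loglog (n : nat) : R := (ln (ln n%:R))^-1.

(* A sequence of weight vectors (one for each n) follows a power law with
   exponent beta: the weights are bounded away from 0 and the number of vertices
   of weight at least x is Theta(n x^(1 - beta)). As usual for this model the
   lower bound is only required up to a cut-off xmax(n), because a pure power
   law with beta < 3 has weights exceeding sqrt W; and, as in Chung and Lu's
   treatment of 2 < beta < 3, the maximum weight is n^(omega(1 / log log n)). *)
Definition power_law beta (w : forall n, 'I_n -> R) : Prop :=
  exists (x0 a b : R) (xmax : nat -> R),
  [/\ [/\ 0 < x0, 0 < a & 0 < b],
      forall n (i : 'I_n), x0 <= w n i,
      forall n (x : R), x0 <= x ->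
        #|[set i | x <= w n i]|%:R <= b * n%:R * x `^ (1 - beta),
      forall n (x : R), x0 <= x <= xmax n ->
        a * n%:R * x `^ (1 - beta) <= #|[set i | x <= w n i]|%:R &
      forall A : R, \forall n \near \oo%classic, n%:R `^ (A * inv_loglog n) <= xmax n].

End ChungLu.

Section CoreGen.
Variables (R : realType) (n : nat) (G : graph n).
Implicit Types (E : pred {set 'I_n}).

Definition best_candidates (L0 L1 : {set 'I_n}) : {set 'I_n} :=
  [set u in L1 | [forall u' in L1,
     #|nbr G u' :&: L0| <= #|nbr G u :&: L0|]%N].

(* The probability, over uniform independent tie-breaking, that the run which
   still has to move m vertices into L0 outputs a set satisfying E. If L1 is
   empty (the component of the starting vertex is exhausted) the run outputs
   the current L0. *)
Fixpoint coregen_from (m : nat) (L0 L1 : {set 'I_n}) E : R :=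
  if m is m'.+1 then
    let B := best_candidates L0 L1 in
    if B == finset.set0 then (E L0)%:R
    else (\sum_(u in B)
            coregen_from m' (u |: L0) ((L1 :|: nbr G u) :\: (u |: L0)) E)
         / #|B|%:R
  else (E L0)%:R.

Definition coregen_pr (k : nat) (v : 'I_n) E : R :=
  coregen_from (k - 1) [set v] (nbr G v) E.

End CoreGen.

Section WormHole.
Variables (n : nat) (G : graph n) (L0 : {set 'I_n}).

Record tree := Tree {
  verts : {set 'I_n};    (* T(i) *)
  ports : {set 'I_n};    (* C(i), empty as long as it has not been recorded *)
  queried : {set 'I_n}   (* all vertices whose neighbor list has been read *)
}.

Definition init_tree (s : 'I_n) : tree := Tree [set s] finset.set0 finset.set0.

(* Reading Gamma(T) means having queried every vertex of T, and this also holds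
   for the final tree, for which C = Gamma(T) :&: L0 is computed. *)
Definition grow (x : tree) : tree :=
  if ports x != finset.set0 then x else
  let T := verts x in
  let T' := T :|: nbrs G T in
  if nbrs G T :&: L0 != finset.set0
  then Tree T' (nbrs G T' :&: L0) (queried x :|: T :|: T')
  else Tree T' finset.set0 (queried x :|: T).

Definition trees_meet (x : tree * tree) : bool :=
  verts x.1 :&: verts x.2 != finset.set0.

Definition both_ports (x : tree * tree) : bool :=
  (ports x.1 != finset.set0) && (ports x.2 != finset.set0).

Definition outer_round (x : tree * tree) : tree * tree :=
  if trees_meet x || both_ports x then x else (grow x.1, grow x.2).

(* n rounds always suffice: by then each tree is either stopped or equal to a
   whole connected component. *)
Definition outer_run (s t : 'I_n) : tree * tree :=
  iter n outer_round (init_tree s, init_tree t).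

(* Bidirectional BFS inside G[L0] between two vertex sets. *)
Definition inner_round (x : {set 'I_n} * {set 'I_n}) :=
  if x.1 :&: x.2 != finset.set0 then x
  else (x.1 :|: (nbrs G x.1 :&: L0), x.2 :|: (nbrs G x.2 :&: L0)).

Definition inner_queried (Cs Ct : {set 'I_n}) : {set 'I_n} :=
  let x := iter n inner_round (Cs, Ct) in x.1 :|: x.2.

(* The vertices of L0 were queried during preprocessing and are not charged. *)
Definition wormhole_queries (s t : 'I_n) : nat :=
  let x := outer_run s t in
  let Q := queried x.1 :|: queried x.2 in
  let Qin := if trees_meet x then finset.set0
             else if both_ports x then inner_queried (ports x.1) (ports x.2)
             else finset.set0 in
  #|(Q :|: Qin) :\: L0|.

Definition avg_queries (R : realType) : R :=
  (\sum_(s : 'I_n) \sum_(t | t != s) (wormhole_queries s t)%:R)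
  / (n * n.-1)%:R.

End WormHole.

(* For every start vertex v: conditionally on CoreGen acquiring a set of size k
   from v, the average query cost is at most B with probability at least
   1 - eps over the ties. (Whether size k is reached does not depend on the
   ties, only on the component of v.) *)
Definition cheap_routing (R : realType) n (k : nat) (B eps : R) (G : graph n)
  : bool :=
  [forall v : 'I_n,
     (1 - eps) * coregen_pr R G k v (fun L0 => #|L0| == k) <=
     coregen_pr R G k v
       (fun L0 => (#|L0| == k) && (avg_queries G L0 R <= B))].

(* Main.v *)
Require Import Defs.
From HB Require Import structures.
From mathcomp Require Import all_boot all_order all_algebra.
From mathcomp Require Import all_classical all_reals all_analysis.
From mathcomp Require Import ring lra zify fintype finset.
Import Order.TTheory GRing.Theory Num.Theory.
Import numFieldNormedType.Exports.
Set Implicit Arguments.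
Unset Strict Implicit.
Unset Printing Implicit Defensive.
Local Open Scope ring_scope.

(* Write L = n^(1 / log log n), and let H be the set of vertices of weight at
   least D, for a suitable power D of L.

   H is contained in L0: suppose that x has weight at least D. As long as x is
   not chosen, CoreGen behaves as on the graph without the edges at x, so these
   edges are independent of the set S acquired after half of the k steps, and x
   has at least a power of L neighbors in S except with probability n^(-3). A
   vertex with so many neighbors in S is preceded only by vertices of large
   degree, of which there are fewer than k / 2.

   Routing is cheap: from s outside H, the ball explored inside G - H is
   determined by edges disjoint from those between its vertices and H, and each
   of its vertices is adjacent to H with probability at least a negative power
   of L. Hence a ball with more than a power of L vertices has a
   neighbor in H, and the search goes on for at most two more levels, whose
   vertices to be expanded lie outside H and have degree O(D). From s in L0 the
   search stops even earlier, because the neighbors of s see s itself. *)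

(** * Random subsets *)

Section ProductMeasure.
Variables (R : realType) (E : finType) (p : E -> R).
Hypothesis p01 : forall e, 0 <= p e <= 1.
Implicit Types (J K A C : {set E}) (F : {set E} -> R).

(** Law of a random subset that contains each [e] independently with probability [p e]; [mean] is
    the expectation under it. *)
Definition wt J : R := \prod_e (if e \in J then p e else 1 - p e).
Definition mean F : R := \sum_(J : {set E}) wt J * F J.

Lemma wt_ge0 J : 0 <= wt J.
Proof.
apply: prodr_ge0 => e _; have /andP[p0 p1] := p01 e.
by case: ifP => _; rewrite ?subr_ge0.
Qed.

Lemma wt_sum1 : \sum_(J : {set E}) wt J = 1.
Proof.
rewrite -(bigA_distr _ _ p (fun e => 1 - p e)).
by apply: big1 => e _; rewrite /= subrKC.
Qed.

Lemma mean_cst (c : R) : mean (fun=> c) = c.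
Proof. by rewrite /mean -mulr_suml wt_sum1 mul1r. Qed.

Lemma eq_mean F F' : F =1 F' -> mean F = mean F'.
Proof. by move=> FF'; apply: eq_bigr => J _; rewrite FF'. Qed.

Lemma le_mean F F' : (forall J, wt J != 0 -> F J <= F' J) -> mean F <= mean F'.
Proof.
move=> FF'; apply: ler_sum => J _.
have [->|/FF'] := eqVneq (wt J) 0; first by rewrite !mul0r.
by apply: ler_wpM2l; exact: wt_ge0.
Qed.

Lemma meanD F F' : mean (fun J => F J + F' J) = mean F + mean F'.
Proof. by rewrite /mean -big_split /=; apply: eq_bigr => J _; rewrite mulrDr. Qed.

Lemma meanZ (c : R) F : mean (fun J => c * F J) = c * mean F.
Proof. by rewrite /mean mulr_sumr; apply: eq_bigr => J _; rewrite mulrCA. Qed.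

Lemma mean_sum (I : finType) (P : pred I) (F : I -> {set E} -> R) :
  mean (fun J => \sum_(i | P i) F i J) = \sum_(i | P i) mean (F i).
Proof.
rewrite /mean exchange_big /=.
by apply: eq_bigr => J _; rewrite mulr_sumr.
Qed.

(* The involution exchanging the parts of J and K outside A preserves the
   product weight of the pair (J, K). *)
Lemma mean_resample A (F : {set E} -> {set E} -> R) :
  mean (fun J => F (J :&: A) (J :\: A)) =
  mean (fun J => mean (fun K => F (J :&: A) (K :\: A))).
Proof.
pose mix (q : {set E} * {set E}) := (q.1 :&: A) :|: (q.2 :\: A).
pose swap (q : {set E} * {set E}) := (mix q, mix (q.2, q.1)).
have swapK : involutive swap.
  move=> [J K]; rewrite /swap /mix /=.
  by congr (_, _); apply/setP => e; rewrite !inE; case: (e \in A) => /=;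
    rewrite ?andbF ?andbT ?orbF.
transitivity (\sum_(q : {set E} * {set E})
    wt q.1 * wt q.2 * F (q.1 :&: A) (q.1 :\: A)).
  rewrite -(pair_bigA _ (fun J K => wt J * wt K * F (J :&: A) (J :\: A))) /=.
  apply: eq_bigr => J _; rewrite -mulr_suml -mulr_sumr wt_sum1.
  by rewrite mulr1.
rewrite (reindex_inj (inv_inj swapK)) /=.
rewrite /mean; under [RHS]eq_bigr => J _ do rewrite mulr_sumr.
rewrite [RHS](pair_bigA _ (fun J K => wt J * (wt K * F (J :&: A) (K :\: A)))) /=.
apply: eq_bigr => -[J K] _ /=; rewrite mulrA; congr (_ * F _ _).
- rewrite /wt -!big_split /=; apply: eq_bigr => e _; rewrite /mix /= !inE.
  by case: (e \in A) => /=; rewrite ?andbF ?andbT ?orbF ?orFb // mulrC.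
- by apply/setP => e; rewrite /mix !inE; case: (e \in A);
    rewrite ?andbF ?andbT ?orbF.
- by apply/setP => e; rewrite /mix !inE; case: (e \in A);
    rewrite ?andbF ?andbT ?orbF.
Qed.

(** The moment generating function factors over the elements, and each factor [1 + (expR l - 1) p e]
    is bounded by an exponential. *)
Lemma mean_expR_card (l : R) C :
  mean (fun J => expR (l * #|C :&: J|%:R)) <=
  expR ((expR l - 1) * \sum_(e in C) p e).
Proof.
pose f e := if e \in C then expR l else 1.
have -> : mean (fun J => expR (l * #|C :&: J|%:R)) =
    \prod_e (p e * f e + (1 - p e)).
  rewrite bigA_distr; apply: eq_bigr => J _.
  have -> : expR (l * #|C :&: J|%:R) = \prod_e (if e \in J then f e else 1).
    rewrite -big_mkcond /= /f -big_mkcondr /= mulrC expRM_natl.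
    by rewrite prodr_const; congr (_ ^+ _); apply: eq_card => e;
      rewrite !inE andbC.
  rewrite /wt -big_split /=; apply: eq_bigr => e _.
  by case: ifP => // _; rewrite mulr1.
rewrite mulr_sumr expR_sum [leRHS]big_mkcond /=.
apply: ler_prod => e _; have /andP[p0 p1] := p01 e.
apply/andP; split.
  apply: addr_ge0; last by rewrite subr_ge0.
  by apply: mulr_ge0 => //; rewrite /f; case: ifP => // _; exact: expR_ge0.
rewrite /f; case: ifP => _; last by rewrite mulr1 subrKC.
by apply: le_trans (expR_ge1Dx _); lra.
Qed.

(** Chernoff bound with parameter -1, where [expR (-1) <= 1 / 2]. *)
Lemma lower_tail C (r : R) :
  mean (fun J => (#|C :&: J|%:R <= r)%R%:R) <=
  expR (r - (\sum_(e in C) p e) / 2).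
Proof.
have s0 : 0 <= \sum_(e in C) p e.
  by apply: sumr_ge0 => e _; case/andP: (p01 e).
apply: (@le_trans _ _ (mean (fun J => expR r * expR (-1 * #|C :&: J|%:R)))).
  apply: le_mean => J _; rewrite -expRD; case: (leP _ r) => h /=.
    by rewrite mulr1n -[leLHS]expR0 ler_expR; lra.
  exact: expR_ge0.
rewrite meanZ expRD ler_pM2l ?expR_gt0 //.
apply: le_trans (mean_expR_card _ _) _; rewrite ler_expR.
have h : expR (-1) <= 1 / 2 :> R.
  rewrite expRN -div1r ler_pM2l // lef_pV2 ?posrE ?expR_gt0 //.
  by have := expR_ge1Dx (1 : R); lra.
by nra.
Qed.

(** Chernoff bound with parameter 1/2, where [expR (1 / 2) <= 2]. *)
Lemma upper_tail C (r : R) :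
  mean (fun J => (r <= #|C :&: J|%:R)%R%:R) <=
  expR (\sum_(e in C) p e - r / 2).
Proof.
have s0 : 0 <= \sum_(e in C) p e.
  by apply: sumr_ge0 => e _; case/andP: (p01 e).
apply: (@le_trans _ _
    (mean (fun J => expR (- (r / 2)) * expR (1 / 2 * #|C :&: J|%:R)))).
  apply: le_mean => J _; rewrite -expRD; case: (leP r _) => h /=.
    by rewrite mulr1n -[leLHS]expR0 ler_expR; lra.
  exact: expR_ge0.
rewrite meanZ addrC expRD ler_pM2l ?expR_gt0 //.
apply: le_trans (mean_expR_card _ _) _; rewrite ler_expR.
have h : expR (1 / 2) <= 2 :> R.
  have e0 := expR_gt0 (1 / 2 : R).
  have h1 := expR_ge1Dx (- (1 / 2) : R); rewrite expRN in h1.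
  rewrite -[leLHS]invrK -[leRHS]invrK lef_pV2 ?posrE ?invr_gt0 //.
  by lra.
by nra.
Qed.

End ProductMeasure.

(** * CoreGen *)

Section Greedy.
Variables (R : realType) (n : nat).
Implicit Types (G : graph n) (S T : {set 'I_n}) (F : {set 'I_n} -> R).

Lemma in_nbr G u v : (u \in nbr G v) = ([set u; v] \in G).
Proof. by rewrite inE. Qed.

Lemma nbr_sym G u v : (u \in nbr G v) = (v \in nbr G u).
Proof. by rewrite !in_nbr setUC. Qed.

Lemma nbrsP G S u : reflect (exists2 v, v \in S & u \in nbr G v) (u \in nbrs G S).
Proof. exact: bigcupP. Qed.

Lemma nbrsU G S T : nbrs G (S :|: T) = nbrs G S :|: nbrs G T.
Proof. exact: bigcup_setU. Qed.

Lemma nbrs1 G v : nbrs G [set v] = nbr G v.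
Proof. exact: big_set1. Qed.

Definition frontier G S := nbrs G S :\: S.

Local Notation best G S := (best_candidates G S (frontier G S)).

(* [coregen_from] with its second argument kept equal to [frontier G S], and
   with a real-valued function in place of the event. *)
Fixpoint greedy G (m : nat) S F : R :=
  if m is m'.+1 then
    if best G S == finset.set0 then F S
    else (\sum_(u in best G S) greedy G m' (u |: S) F) / #|best G S|%:R
  else F S.

Lemma best_sub G S u : u \in best G S -> (u \in nbrs G S) && (u \notin S).
Proof. by rewrite inE in_setD andbC => /andP[_]; rewrite andbC. Qed.

Lemma best_eq0 G S : (best G S == finset.set0) = (frontier G S == finset.set0).
Proof.
apply/idP/idP => [|/eqP f0]; last first.
  by apply/eqP/setP => u; rewrite inE f0 !inE.
apply: contraLR => /set0Pn[x xL]; apply/set0Pn.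
have [u uL umax] := @arg_maxnP _ x (mem (frontier G S))
  (fun u => #|nbr G u :&: S|) xL.
by exists u; rewrite inE [_ \in _]uL; apply/forall_inP => y /umax.
Qed.

Lemma coregen_from_greedy G m S (P : pred {set 'I_n}) :
  coregen_from R G m S (frontier G S) P = greedy G m S (fun T => (P T)%:R).
Proof.
elim: m S => //= m IHm S; case: ifP => // _; congr (_ / _).
apply: eq_bigr => u uB; rewrite -IHm; congr (coregen_from _ _ _ _ _).
apply/setP => y; rewrite /frontier nbrsU nbrs1 !inE.
by case: (y == u) => //=; case: (y \in S) => //=; rewrite orbC.
Qed.

Lemma coregen_pr_greedy G k v (P : pred {set 'I_n}) : v \notin nbr G v ->
  coregen_pr R G k v P = greedy G (k - 1) [set v] (fun T => (P T)%:R).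
Proof.
move=> vG; rewrite -coregen_from_greedy /coregen_pr; congr (coregen_from _ _ _ _ _).
rewrite /frontier nbrs1; apply/setP => y; rewrite [in RHS]inE in_set1.
by case: eqP => //= ->; exact: negbTE.
Qed.

Lemma greedy_le G m S F F' : (forall T, F T <= F' T) ->
  greedy G m S F <= greedy G m S F'.
Proof.
move=> FF'; elim: m S => //= m IHm S; case: ifP => // _.
by rewrite ler_wpM2r ?invr_ge0 ?ler0n // ler_sum.
Qed.

(** [Q] is an invariant indexed by the number of remaining steps. Averages of a constant are that
    constant, so only the two ways to stop need checking: no step left, or an empty frontier. *)
Lemma greedy_inv G (Q : nat -> {set 'I_n} -> Prop) F (c : R) :
    (forall m S u, Q m.+1 S -> u \in best G S -> Q m (u |: S)) ->
    (forall S, Q 0%N S -> F S = c) ->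
    (forall m S, Q m.+1 S -> frontier G S = finset.set0 -> F S = c) ->
  forall m S, Q m S -> greedy G m S F = c.
Proof.
move=> Qstep Q0 Qdead; elim=> [|m IHm] S QS /=; first exact: Q0.
have [b0|b0] := boolP (best G S == finset.set0).
  by apply: Qdead QS _; apply/eqP; rewrite -best_eq0.
rewrite (eq_bigr (fun=> c)); last by move=> u uB; apply/IHm/(Qstep _ _ _ QS).
by rewrite sumr_const -[c *+ _]mulr_natr mulfK // pnatr_eq0 cards_eq0.
Qed.

Lemma greedy_cst G m S (c : R) : greedy G m S (fun=> c) = c.
Proof. exact: (@greedy_inv G (fun _ _ => True)). Qed.

Lemma greedy_mem0 G m S F x : x \in S -> (forall T, x \in T -> F T = 0) ->
  greedy G m S F = 0.
Proof.
move=> xS F0; apply: (@greedy_inv G (fun _ T => x \in T)) => //.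
- by move=> _ T u xT _; rewrite inE xT orbT.
- by move=> _ T /F0.
Qed.

(** Arbitrary coefficients [c] include the weights of a random graph, so an expectation can be moved
    inside a run on a fixed graph. *)
Lemma greedy_sum (I : finType) G m S (c : I -> R) (F : I -> {set 'I_n} -> R) :
  greedy G m S (fun T => \sum_i c i * F i T) = \sum_i c i * greedy G m S (F i).
Proof.
elim: m S => //= m IHm S; case: ifP => // _.
rewrite (eq_bigr _ (fun u _ => IHm (u |: S))) exchange_big mulr_suml /=.
by apply: eq_bigr => i _; rewrite -mulr_sumr mulrA.
Qed.

Lemma greedyD G m S F F' :
  greedy G m S (fun T => F T + F' T) = greedy G m S F + greedy G m S F'.
Proof.
elim: m S => //= m IHm S; case: ifP => // _.
by rewrite (eq_bigr _ (fun u _ => IHm (u |: S))) big_split /= mulrDl.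
Qed.

(** A run that is stuck within the first [a] steps stays stuck afterwards. *)
Lemma greedy_comp G a m S F :
  greedy G (a + m) S F = greedy G a S (fun T => greedy G m T F).
Proof.
elim: a S => //= a IHa S; have [b0|b0] := eqVneq; last first.
  by congr (_ / _); apply: eq_bigr => u _.
by case: m {IHa} => //= m; rewrite b0 eqxx.
Qed.

(* Size k is reached iff the component of v has at least k vertices. *)
Lemma greedy_size01 G k v : (0 < k)%N ->
  let q := greedy G (k - 1) [set v] (fun T => (#|T| == k)%:R) in
  q = 0 \/ q = 1.
Proof.
move=> k0 /=; pose comp := [set u | connect (fun a b => b \in nbr G a) v u].
pose Q m S := [/\ S \subset comp, v \in S & (#|S| + m = k)%N].
have Qstep m S u : Q m.+1 S -> u \in best G S -> Q m (u |: S).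
  move=> [Sc vS cS] /best_sub /andP[/nbrsP[y yS uy] uS]; split.
  - rewrite subUset Sc sub1set inE andbT.
    have := subsetP Sc _ yS; rewrite inE => /connect_trans; apply.
    exact: connect1.
  - by rewrite inE vS orbT.
  - by rewrite cardsU1 uS; lia.
have Qdead m S : Q m.+1 S -> frontier G S = finset.set0 -> comp \subset S.
  move=> [_ vS _] f0; apply/subsetP => u; rewrite inE => /connectP[p].
  move: {1 2 3}v vS => x; elim: p x => [|y p IHp] x xS /=; first by move=> _ ->.
  case/andP => yx /IHp; apply; apply: contraT => yS.
  suff: y \in frontier G S by rewrite f0 inE.
  by rewrite inE yS; apply/nbrsP; exists x.
have Qinit : Q (k - 1)%N [set v].
  split; rewrite ?sub1set ?inE ?connect0 ?cards1 //; lia.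
have [kc|kc] := leqP k #|comp|; [right|left].
- apply: (greedy_inv Qstep) Qinit => [S [_ _ cS]|m S QS f0].
    by rewrite -cS addn0 eqxx.
  have := leq_trans kc (subset_leq_card (Qdead _ _ QS f0)).
  by case: QS => _ _ <-; rewrite addnS ltnNge leq_addr.
- have small S : S \subset comp -> (#|S| == k)%:R = 0 :> R.
    by move=> /subset_leq_card Sc; rewrite (ltn_eqF (leq_ltn_trans Sc kc)).
  by apply: (greedy_inv Qstep) Qinit => [S|m S] [/small].
Qed.

(* Once x has more than d neighbors in S, only vertices of degree more than d
   are chosen before x. *)
Lemma greedy_forced G d m S F x :
    (#|[set u | (d < #|nbr G u|)%N]| < m)%N -> (d < #|nbr G x :&: S|)%N ->
    (forall T, x \in T -> F T = 0) ->
  greedy G m S F = 0.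
Proof.
set D := [set u | _] => Dm dx F0.
(* Each step either takes [x] or removes a vertex from [D :\: S], so [x] is taken before the [m]
   steps run out. *)
pose Q m S := (x \in S) \/ (d < #|nbr G x :&: S|)%N /\ (#|D :\: S| < m)%N.
have QF T : x \notin T -> (d < #|nbr G x :&: T|)%N -> x \in frontier G T.
  move=> xT dT; rewrite inE xT; apply/nbrsP.
  have /card_gt0P[y] : (0 < #|nbr G x :&: T|)%N by lia.
  by rewrite inE => /andP[yx yT]; exists y => //; rewrite nbr_sym.
apply: (@greedy_inv G Q) => [m' T u QT uB|T [/F0|[]]//|m' T QT f0|].
- have [xT|xT] := boolP (x \in T); first by left; rewrite inE xT orbT.
  case: QT => [|[dT DT]]; first by rewrite (negPf xT).
  right; split.
    by apply: leq_trans dT _; apply/subset_leq_card/setIS/subsetUr.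
  have /andP[_ uT] := best_sub uB.
  have ud : u \in D.
    move: uB; rewrite !inE => /andP[_ /forall_inP/(_ x (QF _ xT dT)) le].
    apply: leq_trans dT (leq_trans le _); exact/subset_leq_card/subsetIl.
  have -> : D :\: (u |: T) = (D :\: T) :\ u.
    by apply/setP => y; rewrite !inE negb_or andbA.
  by move: DT; rewrite (cardsD1 u (D :\: T)) in_setD ud uT.
- apply: F0; apply: contraT => xT; case: QT => [|[dT _]]; first by rewrite (negPf xT).
  by have := QF _ xT dT; rewrite f0 inE.
- right; split => //; apply: leq_ltn_trans Dm; exact/subset_leq_card/subsetDl.
Qed.

(** Cut the run after [a] steps. If the set then has at most [a] elements, the final size stays
    below [a.+1 + m]; if [x] has more than [d] neighbors in it, [greedy_forced] brings [x] in. *)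
Lemma greedy_missed G a m d S x :
    (#|[set u | (d < #|nbr G u|)%N]| < m)%N ->
  greedy G (a + m) S (fun T => ((#|T| == a.+1 + m) && (x \notin T))%N%:R) <=
  greedy G a S (fun T =>
    [&& x \notin T, a < #|T| & #|nbr G x :&: T| <= d]%N%:R).
Proof.
move=> Dm; rewrite greedy_comp; apply: greedy_le => T.
set F := (fun T => _).
have F0 (U : {set 'I_n}) : x \in U -> F U = 0 by rewrite /F => ->; rewrite andbF.
have [xT|xT] := boolP (x \in T); first by rewrite (greedy_mem0 _ _ xT).
have [aT|aT] := leqP #|T| a; last first.
  have [dx|dx] := leqP #|nbr G x :&: T| d; last by rewrite (greedy_forced Dm dx).
  rewrite /= -(greedy_cst G m T 1); apply: greedy_le => U.
  by rewrite /F; case: (_ && _).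
rewrite (@greedy_inv G (fun i (U : {set 'I_n}) => #|U| + i <= a + m)%N F 0) //=.
- move=> i U u /= Ui /best_sub/andP[_ uU]; by rewrite cardsU1 uU add1n addSn -addnS.
- move=> U /=; rewrite addn0 -ltnS -addSn => /ltn_eqF eF.
  by rewrite /F eF.
- move=> i U /= Ui _; have /ltn_eqF eF : (#|U| < a.+1 + m)%N.
    by rewrite addSn ltnS (leq_trans (leq_addr _ _) Ui).
  by rewrite /F eF.
- by rewrite leq_add2r.
Qed.

(** * Independence of the run from the edges at one vertex *)

Definition star (x : 'I_n) : graph n := [set e : {set 'I_n} | x \in e].

Lemma nbr_delstar G x u : u != x -> nbr (G :\: star x) u = nbr G u :\ x.
Proof.
move=> ux; apply/setP => y.
by rewrite !inE negb_or [x == y]eq_sym [x == u]eq_sym ux andbT.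
Qed.

(* As long as x is not chosen, the counts compared by the greedy rule and the
   frontier outside x do not depend on the edges at x. *)
Lemma greedy_delstar G m S F x : x \notin S ->
    (forall T, 0 <= F T) -> (forall T, x \in T -> F T = 0) ->
  greedy G m S F <= greedy (G :\: star x) m S F.
Proof.
move=> xS F0 Fx; elim: m S xS => //= m IHm S xS.
set G' := G :\: star x.
have neqx u : u \in S -> u != x by move=> uS; apply: contraNneq xS => <-.
have nbrsE : nbrs G' S = nbrs G S :\ x.
  apply/setP => y; apply/nbrsP/idP => [[u uS]|].
    rewrite nbr_delstar ?neqx // !in_setD1 => /andP[-> yu] /=.
    by apply/nbrsP; exists u.
  rewrite in_setD1 => /andP[yx /nbrsP[u uS yu]]; exists u => //.
  by rewrite nbr_delstar ?neqx // in_setD1 yx.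
have frE : frontier G' S = frontier G S :\ x.
  by rewrite /frontier nbrsE; apply/setP => y; rewrite !inE andbCA.
have cntE u : u != x -> nbr G' u :&: S = nbr G u :&: S.
  move=> ux; rewrite nbr_delstar //; apply/setP => y; rewrite !inE.
  by case: eqP => //= ->; rewrite (negPf xS) andbF.
have g0 H i T : 0 <= greedy H i T F.
  by rewrite -(greedy_cst H i T 0); apply: greedy_le.
have [b0|b0] := boolP (best G S == finset.set0).
  suff -> : best G' S == finset.set0 by [].
  rewrite best_eq0 in b0; rewrite best_eq0 frE (eqP b0).
  by apply/eqP/setP => y; rewrite !inE andbF.
(* If [x] is the only best candidate, the run on [G] takes it and contributes 0. *)
have [bx|/set0Pn[y]] := boolP (best G S :\ x == finset.set0).
  rewrite big1 ?mul0r; last first.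
    move=> u uB; have ux : u = x.
      apply/eqP; apply: contraT => ux.
      by have := in_set0 u; rewrite -(eqP bx) in_setD1 ux uB.
    by apply: (@greedy_mem0 _ _ _ _ x) => //; rewrite ux !inE eqxx.
  case: ifP => // _; apply: mulr_ge0; last by rewrite invr_ge0 ler0n.
  exact: sumr_ge0.
rewrite in_setD1 => /andP[yx yB].
have bE : best G' S = best G S :\ x.
  apply/setP => u; rewrite in_setD1 [in LHS]inE frE in_setD1.
  have [->//|ux /=] := eqVneq u x; rewrite [in RHS]inE.
  have [uf /=|//] := boolP (u \in frontier G S).
  apply/forall_inP/forall_inP => h z zf.
    move: yB; rewrite inE => /andP[yf /forall_inP/(_ z zf) zy].
    apply: leq_trans zy _; rewrite -!cntE //; apply: h.
    by rewrite in_setD1 yx.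
  move: zf; rewrite in_setD1 => /andP[zx zf].
  by rewrite !cntE //; exact: h.
have b'0 : best G' S != finset.set0.
  by apply/set0Pn; exists y; rewrite bE in_setD1 yx.
rewrite (negPf b'0).
(* The term of [x] vanishes; the others, bounded by induction, are divided by a count no larger than
   before. *)
apply: (@le_trans _ _ ((\sum_(u in best G' S) greedy G' m (u |: S) F)
    / #|best G S|%:R)).
  rewrite ler_pM2r ?invr_gt0 ?ltr0n ?card_gt0 //.
  rewrite (bigID (pred1 x)) /= big1 ?add0r; last first.
    move=> u /andP[_ /eqP ->].
    by apply: (@greedy_mem0 _ _ _ _ x) => //; rewrite !inE eqxx.
  rewrite bE (eq_bigl (fun u => u \in best G S :\ x)); last first.
    by move=> u; rewrite in_setD1 andbC.
  apply: ler_sum => u; rewrite in_setD1 => /andP[ux _].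
  by apply: IHm; rewrite !inE negb_or eq_sym ux.
apply: ler_wpM2l; first exact: sumr_ge0.
rewrite lef_pV2 ?posrE ?ltr0n ?card_gt0 // ler_nat bE.
exact/subset_leq_card/subsetDl.
Qed.

End Greedy.

(** * Routing *)

Section Routing.
Variables (n : nat) (G : graph n).
Implicit Types (L H T : {set 'I_n}) (s t u : 'I_n).

Lemma nbrsS T T' : T \subset T' -> nbrs G T \subset nbrs G T'.
Proof.
move=> /subsetP TT'; apply/subsetP => y /nbrsP[u /TT' uT' yu].
by apply/nbrsP; exists u.
Qed.

Definition bfs s (i : nat) : {set 'I_n} :=
  iter i (fun T => T :|: nbrs G T) [set s].

Arguments bfs : simpl never.

Lemma bfsS s i : bfs s i.+1 = bfs s i :|: nbrs G (bfs s i).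
Proof. by []. Qed.

Lemma ports_sub L s i : ports (iter i (grow G L) (init_tree s)) \subset L.
Proof.
elim: i => [|i IHi]; first exact: sub0set.
rewrite iterS /grow; case: ifP => // _; case: ifP => _ /=.
  exact: subsetIr.
exact: sub0set.
Qed.

(** For a search that has stopped, [j] is the first level whose ball sees [L]; one more level is
    then read, which gives [bfs s j.+1]. *)
Lemma queried_sub L s i : exists j, [/\ (j <= i)%N,
    forall j', (j' < j)%N -> nbrs G (bfs s j') :&: L = finset.set0 &
    queried (iter i (grow G L) (init_tree s)) \subset bfs s j.+1].
Proof.
(* The induction also carries the exact state of a search that has not stopped. *)
suff [] : let x := iter i (grow G L) (init_tree s) in
  (exists j, [/\ (j <= i)%N,
    forall j', (j' < j)%N -> nbrs G (bfs s j') :&: L = finset.set0 &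
    queried x \subset bfs s j.+1]) /\
  (ports x = finset.set0 -> [/\ verts x = bfs s i, queried x \subset bfs s i &
    forall j', (j' < i)%N -> nbrs G (bfs s j') :&: L = finset.set0]) by [].
elim: i => [|i [[j [ji jh jq]] IHp]] /=.
  by split=> [|_]; [exists 0%N|]; split; rewrite //= ?sub0set.
set x := iter _ _ _ in jq IHp *; rewrite /grow.
have [p0|pN0] := eqVneq (ports x) finset.set0; last first.
  split=> [|p0]; last by rewrite p0 eqxx in pN0.
  by exists j; rewrite (leq_trans ji).
have [vE qs hits] := IHp p0; rewrite /= vE.
have [h0|hN0] := eqVneq (nbrs G (bfs s i) :&: L) finset.set0 => /=.
  have h' j' : (j' < i.+1)%N -> nbrs G (bfs s j') :&: L = finset.set0.
    by rewrite ltnS leq_eqVlt => /predU1P[->|/hits].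
  have sub : queried x :|: bfs s i \subset bfs s i.+1.
    by rewrite subUset bfsS !(subset_trans _ (subsetUl _ _)).
  split=> [|_]; last by split.
  exists i; split=> //; exact: hits.
split=> [|p']; last first.
  case/negP: hN0; rewrite -subset0 -p'; apply: setSI.
  exact/nbrsS/subsetUl.
exists i; split=> //; rewrite /= !subUset bfsS !subsetUl subsetUr.
by rewrite !andbT (subset_trans qs) ?subsetUl.
Qed.

Lemma inner_queried_sub L T T' : T \subset L -> T' \subset L ->
  inner_queried G L T T' \subset L.
Proof.
move=> TL T'L; rewrite /inner_queried.
suff /(_ n) : forall m, ((iter m (inner_round G L) (T, T')).1 \subset L) &&
  ((iter m (inner_round G L) (T, T')).2 \subset L) by rewrite subUset.
elim=> [|i /andP[h1 h2]] /=; first by rewrite TL.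
rewrite /inner_round; case: ifP => _; first by rewrite h1.
by rewrite !subUset h1 h2 !subsetIr.
Qed.

(** A round either freezes both searches or advances both, so they can be analyzed separately, each
    run for the same number of rounds. *)
Lemma outer_run_grow L s t : exists2 i, (i <= n)%N &
  outer_run G L s t =
  (iter i (grow G L) (init_tree s), iter i (grow G L) (init_tree t)).
Proof.
rewrite /outer_run; suff /(_ n) : forall N, exists2 i, (i <= N)%N &
  iter N (outer_round G L) (init_tree s, init_tree t) =
  (iter i (grow G L) (init_tree s), iter i (grow G L) (init_tree t)) by [].
elim=> [|m [i im /= ->]]; first by exists 0%N.
rewrite /outer_round; case: ifP => _; first by exists i => //; exact: ltnW.
by exists i.+1.
Qed.

(** The vertices read by the inner search lie in [L] and are free, so the two outer balls bound the
    cost. *)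
Lemma wormhole_queries_le L s t : exists j j',
  [/\ (j <= n)%N, (j' <= n)%N,
    forall i, (i < j)%N -> nbrs G (bfs s i) :&: L = finset.set0,
    forall i, (i < j')%N -> nbrs G (bfs t i) :&: L = finset.set0 &
  (wormhole_queries G L s t <=
    #|bfs s j.+1 :\: L| + #|bfs t j'.+1 :\: L|)%N].
Proof.
have [i im xE] := outer_run_grow L s t.
have [j [ji jh jq]] := queried_sub L s i.
have [j' [ji' jh' jq']] := queried_sub L t i.
exists j, j'; split; rewrite ?(leq_trans ji) ?(leq_trans ji') //.
rewrite /wormhole_queries xE /=; set Qin := (if _ then _ else _).
have QinL : Qin \subset L.
  rewrite /Qin; case: ifP => _; first exact: sub0set.
  case: ifP => _; last exact: sub0set.
  by apply: inner_queried_sub; exact: ports_sub.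
apply: leq_trans (leq_card_setU _ _); apply: subset_leq_card.
apply/subsetP => y; rewrite !inE => /andP[yL].
rewrite yL /= => /orP[/orP[/(subsetP jq)|/(subsetP jq')]|].
- by rewrite bfsS inE => ->.
- by rewrite bfsS inE => ->; rewrite orbT.
- by move=> /(subsetP QinL); rewrite (negPf yL).
Qed.

End Routing.

(** * Cost of a single search *)

Section RoutingCost.
Variables (R : realType) (n : nat).
Implicit Types (G : graph n) (L H T : {set 'I_n}) (s t u : 'I_n).

(** [G :&: off H] is G - H, with the vertices of [H] kept as isolated vertices. *)
Definition off H : graph n := [set e : {set 'I_n} | [disjoint e & H]].

Lemma in_nbr_off G H u v : (u \in nbr (G :&: off H) v) =
  [&& u \in nbr G v, u \notin H & v \notin H].
Proof.
rewrite !in_nbr inE; congr (_ && _).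
by rewrite inE -setI_eq0 setIUl setU_eq0 !setI_eq0 !disjoints1.
Qed.

(** A search that has not seen [H] has used no edge at [H], so its ball depends only on the edges of
    G - H. *)
Lemma bfs_off G H s i : s \notin H ->
    (forall j, (j < i)%N -> nbrs G (bfs G s j) :&: H = finset.set0) ->
  bfs G s i = bfs (G :&: off H) s i /\ [disjoint bfs G s i & H].
Proof.
move=> sH; elim: i => [|i IHi] hits; first by rewrite disjoints1.
have [|bE bH] := IHi; first by move=> j ji; apply: hits; exact: ltnW.
have hi := hits i (ltnSn i); split; last first.
  by rewrite -setI_eq0 bfsS setIUl hi setU0 setI_eq0.
rewrite !bfsS -bE; congr (_ :|: _); apply/setP => y.
apply/nbrsP/nbrsP => [[u uT yu]|[u uT]]; last first.
  by rewrite in_nbr_off => /and3P[yu _ _]; exists u.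
exists u => //; rewrite in_nbr_off yu (disjointFr bH uT) andbT /=.
apply/negP => yH; have := in_set0 y; rewrite -hi inE yH andbT.
by move=> /nbrsP[]; exists u.
Qed.

Lemma card_expand G T (D : R) :
    (forall u, u \in T -> #|nbr G u|%:R <= D) ->
  #|T :|: nbrs G T|%:R <= #|T|%:R * (1 + D) :> R.
Proof.
move=> hD; rewrite mulrDr mulr1.
apply: (@le_trans _ _ (#|T|%:R + #|nbrs G T|%:R)).
  by rewrite -natrD ler_nat leq_card_setU.
rewrite lerD2l /nbrs.
apply: (@le_trans _ _ (\sum_(u in T) #|nbr G u|)%:R).
  rewrite ler_nat; apply: (big_rec2 (fun (A : {set 'I_n}) c => #|A| <= c)%N) => [|u c A _ cA].
    by rewrite cards0.
  by apply: leq_trans (leq_card_setU _ _) _; rewrite leq_add2l.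
rewrite natr_sum -sum1_card natr_sum mulr_suml; apply: ler_sum => u /hD.
by rewrite mul1r.
Qed.

Variables (G : graph n) (H : {set 'I_n}) (D M : R).
Hypotheses (D0 : 0 <= D) (M1 : 1 <= M).
Hypothesis low_deg : forall u, u \notin H -> #|nbr G u|%:R <= D.
Hypothesis hit : forall s i, s \notin H -> (i <= n)%N ->
  M <= #|bfs (G :&: off H) s i|%:R ->
  nbrs G (bfs (G :&: off H) s i) :&: H != finset.set0.

(** If [s] is outside [L], the ball two levels before the last has not seen [H], so [hit] keeps it
    below [M]; both further levels expand only vertices outside [H], each multiplying the size by at
    most [1 + D]. If [s] is in [L], its neighbors see it, so the search ends once they are expanded,
    and the possibly large degree of [s] enters only once. *)
Lemma bfs_cost L s j : H \subset L -> (j <= n)%N ->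
    (forall i, (i < j)%N -> nbrs G (bfs G s i) :&: L = finset.set0) ->
  #|bfs G s j.+1 :\: L|%:R <= (1 + #|nbr G s|%:R) * (1 + D) ^+ 2 * M.
Proof.
move=> HL jn hits; set d : R := #|nbr G s|%:R.
have d0 : 0 <= d by rewrite ler0n.
have b1 : #|bfs G s 1|%:R <= 1 + d.
  rewrite /bfs /= nbrs1 -[1 + d](natrD _ 1%N) ler_nat cardsU1.
  by rewrite leq_add2r leq_b1.
have bD : 1 + d <= (1 + d) * (1 + D) ^+ 2 * M.
  rewrite -mulrA ler_peMr ?addr_ge0 // mulr_ege1 // exprn_ege1 //.
  by rewrite lerDl.
have drop i : #|bfs G s i :\: L|%:R <= #|bfs G s i|%:R :> R.
  by rewrite ler_nat; apply/subset_leq_card/subsetDl.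
case: j jn hits => [|j] jn hits; first by rewrite (le_trans (drop _)) ?(le_trans b1).
have lowH T u : T :&: L = finset.set0 -> u \in T -> u \notin H.
  move=> T0 uT; apply/negP => /(subsetP HL) uL.
  by have := in_set0 u; rewrite -T0 inE uT uL.
have [sL|sL] := boolP (s \in L); last first.
  have sH : s \notin H by apply: contra sL => /(subsetP HL).
  have hitsH i : (i < j.+1)%N -> nbrs G (bfs G s i) :&: H = finset.set0.
    by move=> /hits h; apply/eqP; rewrite -subset0 -h; exact: setIS.
  have small : #|bfs G s j|%:R < M.
    have [|bE _] := @bfs_off G H s j sH; first by move=> i /ltnW/hitsH.
    rewrite ltNge; apply/negP; rewrite bE => /(hit sH (ltnW jn)).
    by rewrite -bE hitsH ?eqxx.
  have exp i : (i <= j.+1)%N -> #|bfs G s i.+1|%:R <= #|bfs G s i|%:R * (1 + D).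
    move=> ij; apply: card_expand => u ub; apply: low_deg.
    have [|_ dH] := @bfs_off G H s i sH; last by rewrite (disjointFr dH ub).
    by move=> i' i'i; apply: hitsH; exact: leq_trans i'i ij.
  apply: le_trans (drop _) _.
  apply: le_trans (exp _ (leqnn _)) _.
  apply: (@le_trans _ _ (M * (1 + D) * (1 + D))).
    rewrite ler_wpM2r ?addr_ge0 //; apply: le_trans (exp _ (leqnSn j)) _.
    by rewrite ler_wpM2r ?addr_ge0 // ltW.
  rewrite -mulrA -expr2 mulrC -mulrA ler_peMl ?lerDl //.
  by rewrite mulr_ge0 ?exprn_ge0 ?addr_ge0 // (le_trans ler01).
have N0 := hits 0%N isT; rewrite /bfs /= nbrs1 in N0.
have nbr_low u : u \in nbr G s -> u \notin H by exact: lowH.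
case: j jn hits => [|j] jn hits.
  apply: le_trans (drop _) _.
  have -> : bfs G s 2 = s |: (nbr G s :|: nbrs G (nbr G s)).
    rewrite /bfs /= nbrs1 nbrsU nbrs1 -setUA.
    by rewrite (setUA (nbr G s)) setUid.
  apply: (@le_trans _ _ (1 + d * (1 + D))).
    apply: (@le_trans _ _ (1 + #|nbr G s :|: nbrs G (nbr G s)|%:R)).
      by rewrite -[1 + _](natrD _ 1%N) ler_nat cardsU1 leq_add2r leq_b1.
    by rewrite lerD2l; apply: card_expand => u /nbr_low; exact: low_deg.
  have dD : 0 <= d * D by rewrite mulr_ge0.
  have DD : 0 <= D * D by rewrite mulr_ge0.
  have dDD : 0 <= d * (D * D) by rewrite mulr_ge0.
  apply: (@le_trans _ _ ((1 + d) * (1 + D) ^+ 2)).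
    rewrite -subr_ge0 (_ : _ - _ = 2 * D + D * D + d * D + d * (D * D)).
      by rewrite !addr_ge0 // mulr_ge0.
    by ring.
  by rewrite ler_peMr // mulr_ge0 ?exprn_ge0 ?addr_ge0.
(* Any neighbor of [s] would have shown [s], an element of [L], at level 1, so [s] is isolated. *)
have nbr0 : nbr G s = finset.set0.
  apply/eqP; apply: contraT => /set0Pn[u us].
  have := in_set0 s; rewrite -(hits 1%N isT) inE sL andbT.
  move=> /nbrsP[]; exists u; last by rewrite nbr_sym.
  by rewrite /bfs /= nbrs1 inE us orbT.
have bs i : bfs G s i = [set s].
  elim: i => // i IHi.
  by rewrite bfsS IHi nbrs1 nbr0 setU0.
apply: le_trans (drop _) (le_trans _ bD).
by rewrite bs cards1; lra.
Qed.

End RoutingCost.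

(** * Averaging over pairs *)

Section Average.
Variables (R : realType) (n : nat).

(** Each vertex occurs in [2 (n - 1)] of the [n (n - 1)] ordered pairs. *)
Lemma avg_queries_le (G : graph n) (L : {set 'I_n}) (K : 'I_n -> R) :
    (1 < n)%N ->
    (forall s t, (wormhole_queries G L s t)%:R <= K s + K t) ->
  avg_queries G L R <= 2 / n%:R * \sum_s K s.
Proof.
move=> n1 hK; rewrite /avg_queries.
have n0 : 0 < n%:R :> R by rewrite ltr0n; exact: ltnW.
have n10 : 0 < n.-1%:R :> R by rewrite ltr0n; lia.
rewrite natrM ler_pdivrMr ?mulr_gt0 //.
have cnt (s : 'I_n) : \sum_(t | t != s) K s = n.-1%:R * K s.
  rewrite sumr_const -[K s *+ _]mulr_natl; congr (_%:R * _).
  by rewrite (eq_card (_ : _ =i predC1 s)) // cardC1 card_ord.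
apply: (@le_trans _ _ (\sum_s \sum_(t | t != s) (K s + K t))).
  by apply: ler_sum => s _; apply: ler_sum => t _; exact: hK.
under eq_bigr do rewrite big_split /=.
rewrite big_split /= [X in _ + X](exchange_big_dep xpredT) //=.
rewrite (eq_bigr _ (fun s _ => cnt s)) [X in _ + X](eq_bigr (fun s => n.-1%:R * K s)).
  by rewrite -mulr_sumr le_eqVlt; apply/orP; left; apply/eqP; field; rewrite lt0r_neq0.
by move=> s _; rewrite -cnt; apply: eq_bigl => t; rewrite eq_sym.
Qed.

End Average.

(** * Chung-Lu graphs *)

Section ChungLuGraph.
Variables (R : realType) (n : nat) (w : 'I_n -> R).
Hypothesis hw : cl_weights w.
Hypothesis n1 : (1 < n)%N.
Implicit Types (G : graph n) (S T H : {set 'I_n}) (s u v x : 'I_n).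

Local Notation W := (cl_total w).

(** Sets that are not pairs get probability 0, so that the graph becomes a random subset of all sets
    of vertices. *)
Definition edge_pr (e : {set 'I_n}) : R :=
  if e \in vpairs n then cl_edge_prob w e else 0.

Local Notation expect := (mean edge_pr).

Lemma w_gt0 u : 0 < w u. Proof. by case: hw. Qed.

Lemma cl_total_gt0 : 0 < W.
Proof.
rewrite /cl_total (bigD1 (Ordinal (ltnW n1))) //=; apply: ltr_wpDr (w_gt0 _).
by apply: sumr_ge0 => u _; exact: ltW (w_gt0 u).
Qed.

Lemma edge_pr_pair u v : u != v -> edge_pr [set u; v] = w u * w v / W.
Proof.
move=> uv; rewrite /edge_pr inE cards2 uv eqxx /cl_edge_prob.
by rewrite big_setU1 ?big_set1 // inE.
Qed.

Lemma edge_pr01 e : 0 <= edge_pr e <= 1.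
Proof.
have [eV|eV] := boolP (e \in vpairs n); last by rewrite /edge_pr (negPf eV) lexx ler01.
move: eV; rewrite inE => /cards2P[u [v [uv ->]]].
have W0 := cl_total_gt0; have [_ _ /(_ u v uv) le] := hw.
rewrite edge_pr_pair // ler_pdivrMr // mul1r le andbT divr_ge0 ?ltW //.
by rewrite mulr_gt0 ?w_gt0.
Qed.

Lemma wt_vpairs G : wt edge_pr G != 0 -> G \subset vpairs n.
Proof.
apply: contraR => /subsetPn[e eG eV].
by rewrite /wt (bigD1 e) //= eG /edge_pr (negPf eV) mul0r.
Qed.

Lemma cl_pr_mean (P : pred (graph n)) : cl_pr w P = expect (fun G => (P G)%:R).
Proof.
rewrite /cl_pr /mean [RHS](bigID (mem (powerset (vpairs n)))) /=.
rewrite [X in _ = _ + X]big1 ?addr0; last first.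
  move=> G; rewrite powersetE => h; apply/eqP; rewrite mulf_eq0; apply/orP.
  left; apply: contraNT h; exact: wt_vpairs.
rewrite big_mkcondr /=; apply: eq_bigr => G; rewrite powersetE => GV.
case: (P G); last by rewrite mulr0.
rewrite mulr1 /cl_pmf /wt [RHS](bigID (mem (vpairs n))) /=.
rewrite [X in _ = _ * X]big1 ?mulr1; last first.
  move=> e eV; rewrite /edge_pr (negPf eV) subr0.
  by case: ifP => // /(subsetP GV); rewrite (negPf eV).
by apply: eq_bigr => e eV; rewrite /edge_pr eV.
Qed.

Lemma nbr_irrefl G v : wt edge_pr G != 0 -> v \notin nbr G v.
Proof.
move=> /wt_vpairs/subsetP GV; rewrite in_nbr; apply/negP => /GV.
by rewrite inE setUid cards1.
Qed.

Definition star_edges x S : graph n := [set [set u; x] | u in S].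

Lemma pair_inj x S : x \notin S ->
  {in S &, injective (fun u => [set u; x])}.
Proof.
move=> xS u v uS vS /setP/(_ u); rewrite !inE eqxx /= => /esym/orP[/eqP //|/eqP ux].
by rewrite ux (negPf xS) in uS.
Qed.

Lemma card_star_edges G x S : x \notin S ->
  #|star_edges x S :&: G| = #|nbr G x :&: S|.
Proof.
move=> xS; have -> : star_edges x S :&: G = [set [set u; x] | u in nbr G x :&: S].
  apply/setP => e; apply/setIP/imsetP => [[/imsetP[u uS ->] eG]|[u]].
    by exists u; rewrite // inE uS in_nbr eG.
  by rewrite inE in_nbr => /andP[uG uS] ->; split => //; apply/imsetP; exists u.
rewrite card_in_imset // => u v /setIP[_ uS] /setIP[_ vS]; exact: (pair_inj xS).
Qed.

Lemma sum_star_edges x S : x \notin S ->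
  \sum_(e in star_edges x S) edge_pr e = w x * (\sum_(u in S) w u) / W.
Proof.
move=> xS; rewrite big_imset /=; last exact: pair_inj.
rewrite mulr_sumr mulr_suml; apply: eq_bigr => u uS.
by rewrite edge_pr_pair; [rewrite [w u * _]mulrC|apply: contraNneq xS => <-].
Qed.

(** The expected degree is at most [w s], so [upper_tail] applies; loops have probability 0, so [s]
    can be left out of its own candidate neighbors. *)
Lemma degree_tail s (r : R) :
  expect (fun G => (r <= #|nbr G s|%:R)%R%:R) <= expR (w s - r / 2).
Proof.
have sS : s \notin ~: [set s] by rewrite !inE eqxx.
have W0 := cl_total_gt0.
apply: (@le_trans _ _ (expect
    (fun G => (r <= #|star_edges s (~: [set s]) :&: G|%:R)%R%:R))).
  apply: le_mean => [|G G0]; first exact: edge_pr01.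
  rewrite card_star_edges // (setIidPl _) //.
  apply/subsetP => u us; rewrite !inE; apply: contraTneq us => ->.
  exact: nbr_irrefl.
apply: le_trans (upper_tail edge_pr01 _ _) _.
rewrite ler_expR lerD2r sum_star_edges // ler_pdivrMr // ler_pM2l ?w_gt0 //.
rewrite /cl_total [leRHS](bigID (mem (~: [set s]))) /= lerDl.
by apply: sumr_ge0 => u _; exact: ltW (w_gt0 u).
Qed.

Variable x0 : R.
Hypothesis x00 : 0 <= x0.
Hypothesis wx0 : forall u, x0 <= w u.

Lemma sum_w_ge S : x0 * #|S|%:R <= \sum_(u in S) w u.
Proof.
by rewrite mulr_natr -sumr_const; apply: ler_sum => u _; exact: wx0.
Qed.

Lemma star_lower_tail x S (d : R) : x \notin S ->
  expect (fun G => (#|nbr G x :&: S|%:R <= d)%R%:R) <=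
  expR (d - w x * (x0 * #|S|%:R) / W / 2).
Proof.
move=> xS; rewrite (@eq_mean _ _ _ _ (fun G =>
  (#|star_edges x S :&: G|%:R <= d)%R%:R)); last first.
  by move=> G; rewrite card_star_edges.
apply: le_trans (lower_tail edge_pr01 _ _) _.
rewrite ler_expR lerD2l lerN2 ler_pM2r // sum_star_edges //.
by rewrite ler_pM2r ?invr_gt0 ?cl_total_gt0 // ler_pM2l ?w_gt0 // sum_w_ge.
Qed.

(** The bad event for CoreGen: after the first part of the run, [x] is still outside and has too few
    neighbors to be forced in. *)
Definition missed (a d : nat) x G T : bool :=
  [&& x \notin T, (a < #|T|)%N & (#|nbr G x :&: T| <= d)%N].

(** By [greedy_delstar] the run may be made on the graph without the edges at [x]. These are then
    independent of the acquired set [T], so the number of neighbors of [x] in [T] is a fresh sum to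
    which [star_lower_tail] applies. *)
Lemma mean_missed a d v x :
  expect (fun G => greedy G a [set v] (fun T => (missed a d x G T)%:R)) <=
  expR (d%:R - w x * (x0 * a.+1%:R) / W / 2).
Proof.
set q := expR _.
have [->|xv] := eqVneq v x.
  rewrite (@eq_mean _ _ _ _ (fun=> 0)) ?mean_cst ?expR_ge0 // => G.
  apply: (@greedy_mem0 _ _ _ _ _ _ x); first by rewrite inE.
  by move=> T xT; rewrite /missed xT.
have xS : x \notin [set v] by rewrite inE eq_sym.
pose A := ~: star x.
(* [X] drives the run and [Y] supplies the edges at [x]. *)
pose F (X Y : graph n) := greedy X a [set v] (fun T => (missed a d x Y T)%:R) : R.
apply: (@le_trans _ _ (expect (fun G => F (G :&: A) (G :\: A)))).
  apply: le_mean => [|G _]; first exact: edge_pr01.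
  rewrite /F /A -setDE.
  have -> : (fun T => (missed a d x (G :\: ~: star x) T)%:R) =
            (fun T => (missed a d x G T)%:R) :> (_ -> R).
    apply/funext => T; rewrite /missed; congr (nat_of_bool [&& _, _ & (#|_ :&: _| <= _)%N])%:R.
    by apply/setP => u; rewrite !in_nbr !inE eqxx orbT.
  by apply: greedy_delstar => // T xT; rewrite /missed xT.
rewrite mean_resample /F -[leRHS](mean_cst edge_pr).
apply: le_mean => [|X _]; first exact: edge_pr01.
(* Linearity moves the expectation over the edges at [x] inside the run, so [T] is fixed from here
   on. *)
rewrite /mean -greedy_sum -[leRHS](greedy_cst (X :&: A) a [set v]).
apply: greedy_le => T.
have [xT|xT] := boolP (x \in T).
  rewrite big1 ?expR_ge0 // => G _; by rewrite /missed xT mulr0.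
have [aT|aT] := ltnP a #|T|; last first.
  rewrite big1 ?expR_ge0 // => G _.
  by rewrite /missed [(a < _)%N]ltnNge aT andbF mulr0.
apply: (@le_trans _ _
    (expect (fun G => (#|nbr G x :&: T|%:R <= d%:R :> R)%R%:R))).
  apply: le_mean => [|G _]; first exact: edge_pr01.
  rewrite !ler_nat /missed xT aT /=.
  have -> // : nbr (G :\: A) x = nbr G x.
  by apply/setP => u; rewrite !in_nbr !inE eqxx orbT.
apply: le_trans (star_lower_tail _ xT) _.
rewrite ler_expR lerD2l lerN2 ler_pM2r // ler_pM2r ?invr_gt0 ?cl_total_gt0 //.
by rewrite ler_pM2l ?w_gt0 // ler_wpM2l // ler_nat.
Qed.

(** The bad event for routing: the hypothesis [hit] of [bfs_cost] fails for [s] and [i]. *)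
Definition unhit H (M : R) s i G : bool :=
  let T := bfs (G :&: off H) s i in
  (M <= #|T|%:R) && (nbrs G T :&: H == finset.set0).

(** The ball in G - H is decided by the edges avoiding [H], hence independent of the edges between
    it and [H]. The expected number of these is at least [x0 M w(H) / W], and [lower_tail] with
    threshold 0 bounds the probability that none is present. *)
Lemma mean_unhit H (M : R) s i : s \notin H ->
  expect (fun G => (unhit H M s i G)%:R) <=
  expR (- (x0 * M * (\sum_(h in H) w h) / W / 2)).
Proof.
move=> sH; set q := expR _; have W0 := cl_total_gt0.
pose F (X Y : graph n) : R := (unhit H M s i (X :|: Y))%:R.
rewrite (@eq_mean _ _ _ _ (fun G => F (G :&: off H) (G :\: off H))); last first.
  by move=> G; rewrite /F setID.
rewrite mean_resample -[leRHS](mean_cst edge_pr).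
apply: le_mean => [|X _]; first exact: edge_pr01.
pose T := bfs (X :&: off H) s i.
have TE K : bfs ((X :&: off H :|: K :\: off H) :&: off H) s i = T.
  congr (bfs _ s i); apply/setP => e; rewrite !inE.
  by case: (_ \in X) => //=; case: [disjoint _ & _]; rewrite ?andbF.
have TH : [disjoint T & H].
  rewrite /T; elim: (i) => [|j IHj]; first by rewrite disjoints1.
  rewrite bfsS -setI_eq0 setIUl setU_eq0 setI_eq0 IHj /=.
  apply/eqP/setP => u; rewrite in_set0 inE; apply/negP => /andP[/nbrsP[y _]].
  by rewrite in_nbr_off => /and3P[_ /negPf ->].
have [MT|MT] := leP M #|T|%:R; last first.
  rewrite (@eq_mean _ _ _ _ (fun=> 0)) ?mean_cst ?expR_ge0 // => K.
  by rewrite /F /unhit TE leNgt MT.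
pose C : graph n := [set [set q.1; q.2] | q in setX T H].
apply: (@le_trans _ _ (expect (fun K => (#|C :&: K|%:R <= 0 :> R)%R%:R))).
  apply: le_mean => [|K _]; first exact: edge_pr01.
  rewrite /F /unhit TE MT /= ler_nat.
  have [nh /=|//] := eqVneq (nbrs _ T :&: H) finset.set0; rewrite lt0b.
  rewrite lern0 cards_eq0; apply/eqP/setP => e; rewrite in_set0 inE.
  apply/negP => /andP[/imsetP[[u h] /setXP[/= uT hH] ->] eK].
  have := in_set0 h; rewrite -nh inE hH andbT; move/negP; apply.
  apply/nbrsP; exists u => //; rewrite in_nbr in_setU in_setD.
  suff -> : ([set h; u] \in off H) = false by rewrite setUC eK orbT.
  by rewrite inE -setI_eq0 setIUl setU_eq0 !setI_eq0 !disjoints1 hH.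
apply: le_trans (lower_tail edge_pr01 _ _) _.
rewrite ler_expR sub0r lerN2 ler_pM2r //.
(* [T] and [H] are disjoint, so different pairs give different edges and the sum over [C] is a
   double sum. *)
have Cinj : {in setX T H &, injective (fun q : 'I_n * 'I_n => [set q.1; q.2])}.
  move=> [u h] [u' h'] /setXP[/= uT hH] /setXP[/= uT' hH'] E.
  have := E => /setP/(_ u); rewrite !inE eqxx /=.
  have -> : (u == h') = false.
    by apply/negbTE; apply: contraTneq uT => ->; rewrite (disjointFl TH).
  rewrite orbF => /esym/eqP eu; subst u'; congr (_, _).
  move/setP: E => /(_ h); rewrite !inE eqxx orbT.
  have -> : (h == u) = false.
    by apply/negbTE; apply: contraTneq uT => <-; rewrite (disjointFl TH).
  by move=> /esym/eqP.
rewrite big_imset //= (eq_bigl (fun q => (q.1 \in T) && (q.2 \in H))); last first.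
  by move=> y; rewrite inE.
rewrite -(pair_big (mem T) (mem H) (fun u h => edge_pr [set u; h])) /=.
apply: (@le_trans _ _ (\sum_(u in T) \sum_(h in H) w u * w h / W)); last first.
  apply: ler_sum => u uT; apply: ler_sum => h hH; rewrite edge_pr_pair //.
  by apply: contraTneq uT => ->; rewrite (disjointFl TH).
rewrite [leRHS](eq_bigr (fun u => w u * (\sum_(h in H) w h) / W)); last first.
  by move=> u _; rewrite -mulr_suml -mulr_sumr.
rewrite -mulr_suml -mulr_suml ler_pM2r ?invr_gt0 // ler_wpM2r //.
  by apply: sumr_ge0 => h _; exact: ltW (w_gt0 h).
by apply: le_trans (sum_w_ge T); rewrite ler_wpM2l.
Qed.


(** * Union bound over the bad events *)

Variables (H : {set 'I_n}) (l D M B eps : R) (a d m : nat).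
Hypotheses (eps0 : 0 < eps) (nE : expR l = n%:R) (D0 : 0 <= D) (M1 : 1 <= M).

(** At this degree threshold [degree_tail] gives n^(-2), since [expR l] is [n]. *)
Let r u : R := 2 * w u + 4 * l.

Hypothesis rD : forall u, u \notin H -> r u <= D.
Hypothesis rm : (#|[set u | (d%:R < r u)%R]| < m)%N.
Hypothesis rB : 2 / n%:R * (\sum_s (1 + r s) * (1 + D) ^+ 2 * M) <= B.

(** Weighted count of the bad events: large degrees, unhit balls and, divided by [eps] for Markov's
    inequality, the chances of missing a vertex of [H]. *)
Definition defect G : R :=
  \sum_s (r s <= #|nbr G s|%:R)%R%:R +
  (\sum_(s | s \notin H) \sum_(i < n.+1) ((unhit H M s i G)%:R : R) +
   eps^-1 * \sum_v \sum_(x in H)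
     greedy G a [set v] (fun T => (missed a d x G T)%:R)).

(** Pointwise form of the union bound: if routing is not cheap, one of the three sums in [defect] is
    at least 1. *)
Lemma cheap_or_defect G : (forall v, v \notin nbr G v) ->
  1 <= (cheap_routing (a.+1 + m) B eps G)%:R + defect G.
Proof.
move=> irr; set k := (a.+1 + m)%N.
pose Z v x : R := greedy G a [set v] (fun T => (missed a d x G T)%:R).
have Z0 v x : 0 <= Z v x.
  by rewrite -(greedy_cst G a [set v] (0 : R)); apply: greedy_le => T.
rewrite /defect; set t1 := \sum_s _; set t2 := \sum_(s | _) _.
set t3 := eps^-1 * _.
have t10 : 0 <= t1 by apply: sumr_ge0 => s _; exact: ler0n.
have t20 : 0 <= t2.
  by apply: sumr_ge0 => s _; apply: sumr_ge0 => i _; exact: ler0n.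
have t30 : 0 <= t3.
  apply: mulr_ge0; first by rewrite invr_ge0 ltW.
  apply: sumr_ge0 => v _.
  by apply: sumr_ge0 => x _; exact: Z0.
have [//|/forallPn[v]] := boolP (cheap_routing k B eps G).
  by move=> _; rewrite lerDl !addr_ge0.
rewrite -ltNge !coregen_pr_greedy // => vbad; rewrite add0r.
have [/existsP[s rs]|/existsPn degs] :=
    boolP [exists s, (r s <= #|nbr G s|%:R)%R].
  rewrite -[1]addr0 lerD ?addr_ge0 // /t1 (bigD1 s) //= rs lerDl.
  by apply: sumr_ge0 => u _; exact: ler0n.
have [/existsP[s /andP[sH /existsP[i us]]]|/existsPn hits] :=
    boolP [exists s, (s \notin H) && [exists i : 'I_n.+1, unhit H M s i G]].
  rewrite -[1]add0r lerD // -[1]addr0 lerD // /t2 (bigD1 s) //= (bigD1 i) //= us.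
  rewrite -addrA lerDl addr_ge0 //; apply: sumr_ge0 => j _; first exact: ler0n.
  by apply: sumr_ge0 => i' _; exact: ler0n.
have deg_lt u : #|nbr G u|%:R < r u by rewrite ltNge degs.
have Dm : (#|[set u | (d < #|nbr G u|)%N]| < m)%N.
  apply: leq_ltn_trans rm; apply/subset_leq_card/subsetP => u.
  by rewrite !inE -(ltr_nat R) => /lt_trans; apply.
(* With no large degree and no unhit ball, every [L] containing [H] routes cheaply; what remains is
   the chance that CoreGen misses part of [H]. *)
have cheap (L : {set 'I_n}) : H \subset L -> avg_queries G L R <= B.
  move=> HL; apply: le_trans rB.
  apply: avg_queries_le => // s t.
  have cost z j : (j <= n)%N ->
      (forall i, (i < j)%N -> nbrs G (bfs G z i) :&: L = finset.set0) ->
      #|bfs G z j.+1 :\: L|%:R <= (1 + r z) * (1 + D) ^+ 2 * M.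
    move=> jn zh; apply: le_trans (bfs_cost (H := H) (M := M) D0 M1 _ _ HL jn zh) _.
    - by move=> u uH; apply: ltW (lt_le_trans (deg_lt u) (rD uH)).
    - move=> y i yH ni yM; have := hits y; rewrite yH /= => /existsPn.
      by move=> /(_ (Ordinal (ni : i < n.+1)%N)); rewrite /unhit yM.
    - apply: ler_wpM2r; first exact: le_trans ler01 M1.
      apply: ler_wpM2r; first by rewrite exprn_ge0 // addr_ge0.
      by rewrite lerD2l ltW ?deg_lt.
  have [j [j' [jn jn' jh jh' le]]] := wormhole_queries_le G L s t.
  apply: (@le_trans _ _ (#|bfs G s j.+1 :\: L| + #|bfs G t j'.+1 :\: L|)%:R).
    by rewrite ler_nat.
  by rewrite natrD lerD // cost.
have t3E : t3 = eps^-1 * \sum_v \sum_(x in H) Z v x by [].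
suff : eps <= \sum_(x in H) Z v x.
  move=> epsZ; rewrite -[1]add0r lerD // -[1]add0r lerD // t3E.
  rewrite ler_pdivlMl // mulr1; apply: le_trans epsZ _.
  rewrite [leRHS](bigD1 v) //= lerDl; apply: sumr_ge0 => u _; apply: sumr_ge0 => x _.
  exact: Z0.
move: vbad; set cost := greedy _ _ _ _; set size := greedy _ _ _ _ => vbad.
have cost0 : 0 <= cost.
  rewrite -(greedy_cst G (k - 1) [set v] (0 : R)); apply: greedy_le => T.
  exact: ler0n.
have size_le : size <= cost + \sum_(x in H) Z v x.
  pose lost x T : R := ((#|T| == k) && (x \notin T))%:R.
  apply: (@le_trans _ _ (cost +
      \sum_x (x \in H)%:R * greedy G (k - 1) [set v] (lost x))).
    rewrite -greedy_sum -greedyD; apply: greedy_le => T.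
    have [Tk|Tk] /= := eqVneq #|T| k; last first.
      by rewrite add0r; apply: sumr_ge0 => x _; rewrite mulr_ge0.
    have [HT|/subsetPn[x xH xT]] := boolP (H \subset T).
      rewrite cheap // lerDl; apply: sumr_ge0 => x _; rewrite mulr_ge0 //.
    rewrite -[1%:R]add0r lerD // (bigD1 x) //= xH /lost Tk eqxx xT mul1r lerDl.
    by apply: sumr_ge0 => y _; rewrite mulr_ge0.
  rewrite lerD2l [leRHS]big_mkcond; apply: ler_sum => x _.
  case: (x \in H); last by rewrite mul0r.
  rewrite mul1r /Z (_ : (k - 1 = a + m)%N); last by rewrite /k; lia.
  exact: greedy_missed.
have k0 : (0 < k)%N by [].
(* The conditioning event has probability 0 or 1: for 0 the inequality [vbad] is impossible, for 1
   it leaves at least [eps] to the misses. *)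
have /= := greedy_size01 R G v k0; rewrite -/size => -[s0|s1].
  by move: vbad; rewrite s0 mulr0 ltNge cost0.
by move: vbad size_le; rewrite s1 mulr1; lra.
Qed.

Hypothesis miss : forall x, x \in H ->
  d%:R + 3 * l <= w x * (x0 * a.+1%:R) / W / 2.
Hypothesis hitting : 3 * l <= x0 * M * (\sum_(h in H) w h) / W / 2.

(** The three sums are bounded by [n n^(-2)], [n (n + 1) n^(-3) <= 2 / n] and
    [eps^-1 n^2 n^(-3)]. *)
Lemma cheap_routing_pr :
  1 - (3 + eps^-1) / n%:R <= cl_pr w (cheap_routing (a.+1 + m) B eps).
Proof.
have n0 : 0 < n%:R :> R by rewrite ltr0n; lia.
have n1R : 1 <= n%:R :> R by rewrite ler1n; lia.
have expNl (i : nat) : expR (- (i%:R * l)) = n%:R ^- i.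
  by rewrite expRN expRM_natl nE.
rewrite lerBlDr cl_pr_mean -[leLHS](mean_cst edge_pr).
apply: le_trans (le_mean edge_pr01 _) _.
  by move=> G G0; apply: cheap_or_defect => v; exact: nbr_irrefl G0.
rewrite meanD lerD2l /defect !meanD meanZ !mean_sum.
have -> : (3 + eps^-1) / n%:R = n%:R^-1 + (2 / n%:R + eps^-1 / n%:R) by ring.
apply: lerD; last apply: lerD.
- apply: le_trans (ler_sum _ (fun s _ => degree_tail s (r s))) _.
  rewrite (eq_bigr (fun=> n%:R ^- 2)); last first.
    by move=> s _; rewrite -expNl /r; congr expR; field.
  rewrite sumr_const card_ord -[_ *+ n]mulr_natl le_eqVlt; apply/orP; left.
  by apply/eqP; field; rewrite lt0r_neq0.
- apply: (@le_trans _ _ (\sum_(s : 'I_n) \sum_(i < n.+1) n%:R ^- 3)).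
    rewrite big_mkcond; apply: ler_sum => s _; case: ifPn => sH; last first.
      by apply: sumr_ge0 => i _; rewrite invr_ge0 exprn_ge0.
    rewrite mean_sum; apply: ler_sum => i _.
    apply: le_trans (mean_unhit M i sH) _.
    by rewrite -expNl ler_expR lerN2.
  rewrite !sumr_const !card_ord -[_ *+ n]mulr_natl -[_ *+ n.+1]mulr_natl -natr1.
  have -> : n%:R * ((n%:R + 1) * n%:R ^- 3) = (n%:R + 1) * n%:R ^- 2 :> R.
    by field; rewrite lt0r_neq0.
  rewrite ler_pdivrMr ?exprn_gt0 // expr2 mulrA divfK ?lt0r_neq0 //.
  by lra.
- rewrite ler_pM2l ?invr_gt0 //.
  apply: (@le_trans _ _ (\sum_(v : 'I_n) \sum_(x : 'I_n) n%:R ^- 3)).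
    apply: ler_sum => v _; rewrite mean_sum big_mkcond; apply: ler_sum => x _.
    case: ifPn => xH; last by rewrite invr_ge0 exprn_ge0.
    apply: le_trans (mean_missed a d v x) _.
    by rewrite -expNl ler_expR; have := miss xH; lra.
  rewrite !sumr_const !card_ord -!mulrnA -[_ *+ _]mulr_natl natrM le_eqVlt; apply/orP; left.
  by apply/eqP; field; rewrite lt0r_neq0.
Qed.

End ChungLuGraph.

(** * Power-law weights *)

(** The [k - 1] steps are cut into [h] steps that gather [h.+1] vertices and [m] steps that force
    heavy vertices in; each part must be a constant fraction of [k]. *)
Lemma split_near_half (k : nat) : (1 < k)%N ->
  exists h m, [/\ k = h.+1 + m, k <= 2 * m & k <= 4 * h.+1]%N.
Proof.
move=> k1; exists (k./2.-1), (uphalf k).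
have := odd_double_half k; rewrite uphalf_half; case: odd => /=; split; lia.
Qed.

Lemma query_exponent (c : nat) : (6 * c + 17 = ((2 * c + 4) * 3 + 4).+1)%N.
Proof. lia. Qed.

Lemma threshold_exponent (c : nat) : (2 * c + 4 = c.+1 + c.+1 + 2)%N.
Proof. lia. Qed.

Section PowerLaw.
Variables (R : realType) (n : nat) (w : 'I_n -> R).
Hypothesis hw : cl_weights w.

Lemma harmonic_le (N : nat) : (0 < N)%N ->
  \sum_(i < N) i.+1%:R^-1 <= 1 + ln N%:R :> R.
Proof.
case: N => // N _; elim: N => [|N IHN].
  by rewrite big_ord_recl big_ord0 ln1 invr1.
rewrite big_ord_recr /=; apply: le_trans (lerD IHN (lexx _)) _.
rewrite -addrA lerD2l.
have N1 : 0 < N.+1%:R :> R by rewrite ltr0n.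
have N2 : 0 < N.+2%:R :> R by rewrite ltr0n.
(* Gives [ln N.+1 <= ln N.+2 - 1 / N.+2] through [ln (1 + y) <= y]. *)
have E : N.+1%:R = N.+2%:R * (1 + - N.+2%:R^-1) :> R.
  by rewrite mulrDr mulrN mulr1 divff ?lt0r_neq0 // -[N.+2%:R]natr1 addrK.
have q0 : 0 < 1 + - N.+2%:R^-1 :> R by rewrite -(pmulr_rgt0 _ N2) -E.
rewrite [in ln N.+1%:R]E lnM ?posrE //.
have h : ln (1 + - N.+2%:R^-1) <= - N.+2%:R^-1 :> R.
  by apply: le_ln1Dx; rewrite -subr_gt0 opprK addrC.
by rewrite -addrA gerDl -(subrr N.+2%:R^-1) addrC lerD2l.
Qed.

Variables (beta x0 b : R).
Hypotheses (beta2 : 2 < beta) (b0 : 0 < b) (x00 : 0 < x0).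
Hypothesis wx0 : forall i, x0 <= w i.
Hypothesis upper : forall x, x0 <= x ->
  #|[set i | x <= w i]|%:R <= b * n%:R * x `^ (1 - beta).

Lemma card_heavy_le x : x0 <= x -> 1 <= x ->
  #|[set i | x <= w i]|%:R <= b * n%:R / x.
Proof.
move=> x0x x1; apply: le_trans (upper x0x) _.
apply: ler_wpM2l; first by rewrite mulr_ge0 // ltW.
rewrite -powR_inv1 ?(le_trans ler01) //; apply: ler_powR => //.
by have := beta2; lra.
Qed.

(** The first [i.+1] vertices all weigh at least [w i]; comparing with the power-law count bounds
    [w i]. *)
Lemma weight_le (i : 'I_n) : w i <= 1 + b * n%:R / i.+1%:R.
Proof.
have i0 : 0 < i.+1%:R :> R by rewrite ltr0n.
have c0 : 0 <= b * n%:R / i.+1%:R by rewrite divr_ge0 // mulr_ge0 // ltW.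
have [w1|w1] := leP (w i) 1; first by rewrite (le_trans w1) // lerDl.
have wi0 : 0 < w i by rewrite (lt_trans ltr01).
have := card_heavy_le (wx0 i) (ltW w1).
have le_i : (i.+1 <= #|[set j | (w i <= w j)%R]|)%N.
  have inj : injective (widen_ord (ltn_ord i)).
    by move=> j j' /(congr1 val) /= jj'; exact: val_inj.
  rewrite -[X in (X <= _)%N]card_ord -(card_imset _ inj).
  apply/subset_leq_card/subsetP => j /imsetP[j' _ ->]; rewrite inE.
  by have [_ mono _] := hw; apply: mono; rewrite -ltnS /= ltn_ord.
have : i.+1%:R <= #|[set j | w i <= w j]|%:R :> R by rewrite ler_nat.
move=> /le_trans h /h; rewrite ler_pdivlMr // mulrC -ler_pdivlMr // => le.
by rewrite (le_trans le) // lerDr.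
Qed.

(** The bound by rank sums to a harmonic series; the logarithmic loss is absorbed by [L] later. *)
Lemma cl_total_le : (0 < n)%N ->
  cl_total w <= n%:R * (1 + b * (1 + ln n%:R)).
Proof.
move=> n0; apply: (@le_trans _ _ (\sum_(i < n) (1 + b * n%:R * i.+1%:R^-1))).
  by apply: ler_sum => i _; exact: weight_le.
rewrite big_split /= sumr_const card_ord -mulr_sumr mulrDr mulr1 lerD2l.
rewrite [b * _]mulrC -mulrA; apply: ler_wpM2l => //; apply: ler_wpM2l; first exact: ltW.
exact: harmonic_le.
Qed.


Variables (a eps L : R) (c k : nat).
Hypotheses (beta3 : beta < 3) (a0 : 0 < a) (eps0 : 0 < eps).

Let l : R := ln n%:R.
(** Of the exponent, [c + 1] pays for the neighbor threshold [d], another [c + 1] for [cl_total w]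
    against [k], and 2 for constants. *)
Let D : R := L ^+ (2 * c + 4).

Hypothesis lower : a * n%:R * D `^ (1 - beta) <= #|[set i | D <= w i]|%:R.
Hypotheses (n1 : (1 < n)%N) (k1 : (1 < k)%N) (l1 : 1 <= l).
Hypothesis Lbl : (1 + 2 * b) * l <= L.
Hypotheses (Lx0 : x0 <= L) (L80 : 80 / x0 <= L).
Hypotheses (L6 : 6 / (x0 * a) <= L) (L686 : 686 <= L).
Hypothesis nk : n%:R <= k%:R * L ^+ c.

(** All parameters of [cheap_routing_pr] become powers of [L] up to constants, which the lower
    bounds on [L] absorb. *)
Lemma cheap_routing_pr_power_law :
  1 - (3 + eps^-1) / n%:R <=
  cl_pr w (cheap_routing k (L ^+ (6 * c + 17)) eps).
Proof.
have n0 : 0 < n%:R :> R by rewrite ltr0n; exact: ltnW.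
have l1' := l1.
have L1 : 1 <= L by apply: le_trans L686; rewrite ler1n.
have L0 : 0 < L by exact: lt_le_trans L1.
have b20 : 0 < 2 * b by rewrite mulr_gt0.
have bl0 : 0 <= 2 * b * (l - 1) by apply: mulr_ge0; [exact: ltW|rewrite subr_ge0].
have lL : l <= L by move: Lbl; rewrite mulrDl mul1r; lra.
have bL : 2 * b < L by move: Lbl l1; rewrite mulrDl mul1r; lra.
have W0 := cl_total_gt0 hw n1.
have WL : cl_total w <= n%:R * L.
  apply: le_trans (cl_total_le (ltnW n1)) _; rewrite ler_pM2l //.
  by move: Lbl; rewrite -/l; nra.
have Lp i : 0 < L ^+ i by rewrite exprn_gt0.
have Lge1 i : 1 <= L ^+ i by rewrite exprn_ege1.
have D_gt0 : 0 < D by exact: Lp.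
pose H := [set i | D <= w i].
(* [r u > y] forces weight above [L ^+ c.+1]; at most [b n / L ^+ c.+1] vertices weigh that much,
   fewer than [m] because [n <= k L ^+ c] and [2 b < L]. *)
pose y := 2 * L ^+ c.+1 + 4 * l.
have l0 : 0 <= l by exact: le_trans l1.
have y0 : 0 <= y by rewrite addr_ge0 // mulr_ge0 // ltW.
pose d := (Num.truncn y).+1.
have /andP[yd dy] : (y <= d%:R) && (d%:R <= y + 1).
  have /andP[h1 h2] := truncn_itv y0.
  by rewrite /d (ltW h2) -natr1 lerD2r.
have LcS : L <= L ^+ c.+1 by rewrite exprS ler_peMr // ltW.
have kR : 2 <= k%:R :> R by rewrite ler_nat.
have [h [m [hE km kh]]] := split_near_half k1.
have mk : k%:R <= 2 * m%:R :> R by rewrite -natrM ler_nat.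
have hk : k%:R <= 4 * h.+1%:R :> R by rewrite -natrM ler_nat.
rewrite {1}hE.
(* Outside [H], [r] is at most [2 D + 4 l <= 6 D]. In [M = D L ^+ 3] the factor [D] offsets
   [w(H) >= a n / D], and the three factors [L] pay for [cl_total w <= n L], for [l <= L] and for
   constants. *)
apply: (@cheap_routing_pr R n w hw n1 x0 (ltW x00) wx0 H l (6 * D)
  (D * L ^+ 3) _ eps h d m eps0) => //.
- by rewrite /l lnK // posrE.
- by rewrite mulr_ge0 // ltW.
- by rewrite mulr_ege1 // /D.
- move=> u; rewrite inE -ltNge => /ltW wD.
  have : L <= D by rewrite /D addnS exprS ler_peMr // ltW.
  by move: wD lL; lra.
- rewrite -(ltr_nat R).
  apply: (@le_lt_trans _ _ #|[set i | L ^+ c.+1 <= w i]|%:R).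
    rewrite ler_nat; apply/subset_leq_card/subsetP => u; rewrite !inE => du.
    by move: (le_lt_trans yd du); rewrite /y; lra.
  apply: le_lt_trans (card_heavy_le _ _) _ => //; first exact: le_trans LcS.
  rewrite ltr_pdivrMr //.
  have : b * n%:R <= b * (2 * m%:R * L ^+ c).
    by rewrite ler_pM2l // (le_trans nk) // ler_wpM2r // ltW.
  move=> /le_lt_trans; apply; rewrite exprS.
  have m0 : 0 < m%:R :> R by lra.
  have -> : b * (2 * m%:R * L ^+ c) = m%:R * (2 * b * L ^+ c) by ring.
  by rewrite ltr_pM2l // ltr_pM2r.
(* The average of [1 + r] is at most [1 + 2 L + 4 l <= 7 L]. *)
- have S : \sum_s (1 + (2 * w s + 4 * l)) <= n%:R * (7 * L).
    rewrite big_split /= big_split /= !sumr_const card_ord -mulr_sumr.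
    rewrite -[X in _ + (_ + X)]mulr_natl -/(cl_total w).
    have nl : n%:R * l <= n%:R * L by rewrite ler_pM2l.
    have nL : n%:R * 1 <= n%:R * L by rewrite ler_pM2l.
    by move: WL nl nL; lra.
  have X : (1 + 6 * D) ^+ 2 <= (7 * D) ^+ 2.
    have D1 : 1 <= D by rewrite /D.
    have D7 : 1 + 6 * D <= 7 * D by move: D1; lra.
    by apply: lerXn2r; rewrite // nnegrE ?addr_ge0 // mulr_ge0 // ltW.
  have S0 : 0 <= \sum_s (1 + (2 * w s + 4 * l)).
    apply: sumr_ge0 => s _; rewrite !addr_ge0 // mulr_ge0 //.
    by apply: ltW; case: hw.
  rewrite -!mulr_suml.
  apply: (@le_trans _ _ (2 / n%:R * (n%:R * (7 * L) * (7 * D) ^+ 2 * (D * L ^+ 3)))).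
    apply: ler_wpM2l; first by rewrite divr_ge0.
    apply: ler_wpM2r; first by rewrite mulr_ge0 // ltW.
    by apply: ler_pM => //; rewrite exprn_ge0 // addr_ge0 // mulr_ge0 // ltW.
  have -> : L ^+ (6 * c + 17) = L * (D ^+ 3 * L ^+ 4).
    by rewrite query_exponent exprS exprD [L ^+ (_ * 3)]exprM.
  have -> : 2 / n%:R * (n%:R * (7 * L) * (7 * D) ^+ 2 * (D * L ^+ 3)) =
      686 * (D ^+ 3 * L ^+ 4).
    by field; rewrite lt0r_neq0.
  by apply: ler_wpM2r => //; rewrite mulr_ge0 // exprn_ge0 // ltW.
- move=> x; rewrite inE => Dx.
  set Q := L ^+ c.+1; have Q1 : 1 <= Q by exact: Lge1.
  have dl : d%:R + 3 * l <= 10 * Q.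
    by move: dy LcS lL Q1; rewrite /y -/Q; lra.
  have WQ : cl_total w <= 4 * h.+1%:R * Q.
    apply: le_trans WL _.
    rewrite /Q exprSr mulrA ler_pM2r //; apply: le_trans nk _.
    by rewrite ler_wpM2r // ltW.
  rewrite ler_pdivlMr // ler_pdivlMr //.
  apply: (@le_trans _ _ (10 * Q * 2 * (4 * h.+1%:R * Q))).
    apply: ler_pM => //; first by rewrite !mulr_ge0 ?addr_ge0 // mulr_ge0.
      exact: ltW.
    by rewrite ler_pM2r.
  apply: (@le_trans _ _ (D * (x0 * h.+1%:R))); last first.
    by rewrite ler_pM2r // mulr_gt0 ?ltr0n.
  have -> : D = Q * Q * L ^+ 2 by rewrite /D threshold_exponent !exprD.
  have -> : 10 * Q * 2 * (4 * h.+1%:R * Q) = Q * Q * h.+1%:R * 80 by ring.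
  have -> : Q * Q * L ^+ 2 * (x0 * h.+1%:R) = Q * Q * h.+1%:R * (x0 * L ^+ 2).
    by ring.
  apply: ler_wpM2l; first by rewrite !mulr_ge0 // ltW // Lp.
  rewrite mulrC -ler_pdivrMr //; apply: le_trans L80 _.
  by rewrite expr2 ler_peMr // ltW.
(* Since [beta < 3], at least [a n D ^- 2] vertices weigh at least [D]. *)
- have SH : a * n%:R <= D * \sum_(u in H) w u.
    apply: (@le_trans _ _ (D * (D * #|H|%:R))); last first.
      rewrite ler_pM2l // mulr_natr -sumr_const; apply: ler_sum => u.
      by rewrite inE.
    apply: (@le_trans _ _ (D * (D * (a * n%:R * D ^- 2)))).
      by rewrite le_eqVlt; apply/orP; left; apply/eqP; field; rewrite lt0r_neq0.
    rewrite ler_pM2l // ler_pM2l //; apply: le_trans lower.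
    apply: ler_wpM2l; first by rewrite mulr_ge0 // ltW.
    rewrite -(powR_invn 2 (ltW D_gt0)); apply: ler_powR; first by rewrite /D.
    by move: beta3; lra.
  rewrite ler_pdivlMr // ler_pdivlMr //.
  apply: (@le_trans _ _ (3 * L * 2 * (n%:R * L))).
    apply: ler_pM => //; first by rewrite !mulr_ge0.
      exact: ltW.
    by rewrite ler_pM2r // ler_pM2l.
  have -> : x0 * (D * L ^+ 3) * \sum_(u in H) w u =
      x0 * L ^+ 3 * (D * \sum_(u in H) w u) by ring.
  apply: (@le_trans _ _ (x0 * L ^+ 3 * (a * n%:R))); last first.
    by rewrite ler_pM2l // mulr_gt0.
  have -> : 3 * L * 2 * (n%:R * L) = n%:R * L ^+ 2 * 6 by ring.
  have -> : x0 * L ^+ 3 * (a * n%:R) = n%:R * L ^+ 2 * (L * (x0 * a)) by ring.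
  apply: ler_wpM2l; first by rewrite mulr_ge0 // ltW.
  by rewrite -ler_pdivrMr // mulr_gt0.
Qed.

End PowerLaw.

(** * Asymptotics *)

Lemma cl_pr_le1 (R : realType) n (w : 'I_n -> R) (P : pred (graph n)) :
  cl_weights w -> (1 < n)%N -> cl_pr w P <= 1.
Proof.
move=> hw n1; rewrite cl_pr_mean // -[leRHS](mean_cst (edge_pr w)).
by apply: le_mean => [|G _]; [exact: edge_pr01|case: (P G)].
Qed.

(** * Growth of n^(1 / log log n) *)

Section LogLog.
Variable R : realType.
Implicit Types (n c : nat) (K : R).

Lemma near_loglog K :
  \forall n \near \oo%classic, [/\ (1 < n)%N, 1 <= ln n%:R :> R & K <= ln (ln n%:R)].
Proof.
near=> n.
have h : expR (expR (Num.max 0 K)) <= n%:R by near: n; exact: nbhs_infty_ger.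
have n0 : 0 < n%:R :> R by apply: lt_le_trans h; exact: expR_gt0.
have lE : expR (Num.max 0 K) <= ln n%:R.
  by rewrite -ler_expR lnK // posrE.
have l1 : 1 <= ln n%:R :> R.
  apply: le_trans lE; rewrite -[leLHS]expR0 ler_expR le_max lexx //.
split => //.
  rewrite -(ltr_nat R); apply: lt_le_trans h.
  by rewrite expR_gt1 expR_gt0.
rewrite -ler_expR lnK ?posrE ?(lt_le_trans ltr01) //.
by apply: le_trans lE; rewrite ler_expR le_max lexx orbT.
Unshelve. all: by end_near. Qed.

Lemma powR_natmul (x y : R) (i : nat) : x `^ (i%:R * y) = (x `^ y) ^+ i.
Proof. by rewrite mulrC powRrM powR_mulrn // powR_ge0. Qed.

(** With z = log log n the base is exp(e^z / z), so comparisons reduce to inequalities in z. *)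
Lemma loglog_base n : 1 <= ln n%:R :> R ->
  n%:R `^ inv_loglog R n = expR (expR (ln (ln n%:R)) / ln (ln n%:R)).
Proof.
move=> l1; have n0 : n%:R != 0 :> R.
  by apply: contraTneq l1 => ->; rewrite ln0 // -ltNge ltr01.
by rewrite /powR (negPf n0) lnK ?posrE ?(lt_le_trans ltr01) // mulrC.
Qed.

(** Reduces to [2 z ^+ 2 <= expR z], which the cubic term [z ^+ 3 / 6] gives for [z >= 12]. *)
Lemma loglog_base_ge K n : 1 <= ln n%:R :> R ->
  12 <= ln (ln n%:R) :> R -> K <= ln (ln n%:R) ->
  K * ln n%:R <= n%:R `^ inv_loglog R n.
Proof.
move=> l1 z12 Kz; rewrite loglog_base //.
have lE : ln n%:R = expR (ln (ln n%:R)) :> R.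
  by rewrite lnK // posrE (lt_le_trans ltr01).
rewrite [X in K * X]lE; move: (ln (ln _)) z12 Kz => z z12 Kz.
have z0 : 0 < z by apply: lt_le_trans z12; rewrite ltr0n.
apply: (@le_trans _ _ (expR z * expR z)).
  rewrite ler_pM2r ?expR_gt0 //; apply: le_trans Kz _.
  by apply: le_trans (expR_ge1Dx z); rewrite lerDr.
rewrite -expRD ler_expR ler_pdivlMr //.
apply: le_trans (expR_ge1Dxn 2 (ltW z0)).
rewrite (_ : 3`! = 6%N) // !exprS expr0 mulr1.
have : 0 <= z * z * (z - 12) by rewrite !mulr_ge0 ?subr_ge0 // ltW.
by lra.
Qed.

(** Serves to show [k >= 2]. For [z >= 2 c] the exponent [c expR z / z] is at most [expR z / 2]. *)
Lemma loglog_base_pow c n : 1 <= ln n%:R :> R ->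
  2 <= ln (ln n%:R) :> R -> 2 * c%:R <= ln (ln n%:R) :> R ->
  2 * (n%:R `^ inv_loglog R n) ^+ c <= n%:R.
Proof.
move=> l1 z2 cz; rewrite loglog_base // -expRM_natl.
have lE : ln n%:R = expR (ln (ln n%:R)) :> R.
  by rewrite lnK // posrE (lt_le_trans ltr01).
have n0 : 0 < n%:R :> R.
  by rewrite lt_neqAle ler0n andbT eq_sym; apply: contraTneq l1 => ->;
    rewrite ln0 // -ltNge ltr01.
have nE : n%:R = expR (expR (ln (ln n%:R))) :> R by rewrite -lE lnK ?posrE.
rewrite [leRHS]nE; move: (ln (ln _)) z2 cz => z z2 cz.
have z0 : 0 < z by apply: lt_le_trans z2; rewrite ltr0n.
have ez : 2 <= expR z.
  by apply: le_trans (expR_ge1Dx z); lra.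
have e2 : 2 <= expR 1 :> R by apply: le_trans (expR_ge1Dx 1); lra.
apply: (@le_trans _ _ (expR 1 * expR (expR z / 2))).
  apply: ler_pM => //.
  rewrite ler_expR mulrCA; apply: ler_wpM2l; first exact: expR_ge0.
  rewrite ler_pdivrMr //; by lra.
by rewrite -expRD ler_expR; lra.
Qed.

End LogLog.

Unset Implicit Arguments.
Local Open Scope classical_set_scope.
Local Open Scope ring_scope.

Theorem mainTheorem3 (R : realType) (beta : R) (w : forall n, 'I_n -> R)
  (k : nat -> nat) (eta : nat -> R)
  (hbeta : 2 < beta < 3)
  (hw : \forall n \near \oo, cl_weights (w n))
  (hpow : power_law beta w)
  (heta : eta \is 'Theta_\oo(@inv_loglog R))
  (hk : \forall n \near \oo, (k n)%:R = n%:R `^ (1 - eta n) :> R) :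
  exists2 delta : nat -> R,
    delta \is 'Theta_\oo(@inv_loglog R) &
    forall eps : R, 0 < eps ->
      cl_pr (w n) (cheap_routing (k n) (n%:R `^ delta n) eps) @[n --> \oo]
        --> (1 : R).
Proof.
have /andP[beta2 beta3] := hbeta.
have [x0 [a [b [xmax [[x00 a0 b0] wx0 upper lower xmaxP]]]]] := hpow.
move/asboolP: heta => [[k1 k2] /= /andP[_ k20] etaP].
(* An integer above the upper constant of [eta], so that [n <= k L ^+ c]. *)
pose c := (Num.truncn k2).+1.
have k2c : k2 <= c%:R by have /andP[_ /ltW] := truncn_itv (ltW k20).
(* Makes n^delta equal to [L ^+ (6 c + 17)]. *)
pose t : R := (6 * c + 17)%:R.
have t0 : 0 < t by rewrite /t ltr0n addn_gt0 orbT.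
exists (fun n => t * inv_loglog R n).
  apply/asboolP; exists (t, t) => /=; first by rewrite t0.
  by near=> n; rewrite normrM gtr0_norm.
move=> eps eps0; apply/cvgrPdist_le => e e0.
(* A sum of positive terms that dominates every constant [L] has to exceed. *)
pose K := (1 + 2 * b) + x0 + 80 / x0 + 6 / (x0 * a) + 686.
near=> n.
have hwn : cl_weights (w n) by near: n.
have hkn : (k n)%:R = n%:R `^ (1 - eta n) :> R by near: n.
have [_ etan] : k1 * `|inv_loglog R n| <= `|eta n| /\
  `|eta n| <= k2 * `|inv_loglog R n| by near: n.
(* The weight threshold [L ^+ (2 c + 4)] stays below the cut-off, where the lower power-law bound
   holds. *)
have xmaxn : n%:R `^ ((2 * c + 4)%:R * inv_loglog R n) <= xmax n.
  by near: n; exact: xmaxP.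
have [n1 l1 zn] : [/\ (1 < n)%N, 1 <= ln n%:R :> R &
    Num.max (Num.max 12 K) (2 * c%:R) <= ln (ln n%:R)].
  by near: n; exact: near_loglog.
have ne : (3 + eps^-1) / e <= n%:R by near: n; exact: nbhs_infty_ger.
move: zn; rewrite !ge_max => /andP[/andP[z12 Kz] cz].
set L := n%:R `^ inv_loglog R n.
have KL : K * ln n%:R <= L by exact: loglog_base_ge.
have cL : 2 * L ^+ c <= n%:R by apply: loglog_base_pow => //; lra.
have n0 : 0 < n%:R :> R by rewrite ltr0n; exact: ltnW.
have n1R : 1 <= n%:R :> R by rewrite ler1n; exact: ltnW.
have L0 : 0 < L by exact: powR_gt0.
have p1 : 0 < 80 / x0 by rewrite divr_gt0.
have p2 : 0 < 6 / (x0 * a) by rewrite divr_gt0 // mulr_gt0.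
have K1 : K <= L.
  by apply: le_trans KL; rewrite ler_peMr // /K; lra.
have inv0 : 0 <= inv_loglog R n by rewrite invr_ge0; lra.
have nk : n%:R <= (k n)%:R * L ^+ c.
  rewrite hkn -powR_natmul -powRD; last by rewrite lt0r_neq0 ?implybT.
  rewrite -[leLHS]powRr1 //; apply: ler_powR => //.
  have := ler_norm (eta n); move: etan; rewrite (ger0_norm inv0) => h1 h2.
  have : k2 * inv_loglog R n <= c%:R * inv_loglog R n by rewrite ler_wpM2r.
  by lra.
have k1n : (1 < k n)%N.
  rewrite -(ler_nat R) -(ler_pM2r (exprn_gt0 c L0)).
  exact: le_trans cL nk.
have LxmaxE : L ^+ (2 * c + 4) <= xmax n by rewrite -powR_natmul.
have bl0 : (1 + 2 * b) * ln n%:R <= L.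
  apply: le_trans KL; rewrite ler_pM2r ?(lt_le_trans ltr01) //.
  by rewrite /K; lra.
have L1 : 1 <= L by move: K1; rewrite /K; lra.
have xD : x0 <= L ^+ (2 * c + 4) <= xmax n.
  rewrite LxmaxE andbT; apply: (@le_trans _ _ L).
    by move: K1; rewrite /K; lra.
  by rewrite addnS exprS ler_peMr // ?exprn_ege1 // ltW.
have main := @cheap_routing_pr_power_law R n (w n) hwn beta x0 b beta2 b0 x00
  (wx0 n) (upper n) a eps L c (k n) beta3 a0 eps0 (lower n _ xD) n1 k1n l1 bl0.
rewrite ger0_norm; last by rewrite subr_ge0 cl_pr_le1.
rewrite /t powR_natmul -/L.
have /main : x0 <= L by move: K1; rewrite /K; lra.
move=> /(_ _ _ _ nk) h.
have : 1 - (3 + eps^-1) / n%:R <= cl_pr (w n) (cheap_routing (k n)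
    (L ^+ (6 * c + 17)) eps) by apply: h; move: K1; rewrite /K; lra.
move: ne; rewrite ler_pdivrMr // mulrC -ler_pdivrMr //.
by lra.
Unshelve. all: by end_near. Qed.
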